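(* Let $T$ be a complete local theory in the sort $D$ satisfying the doubling property (DP), and let $M$ be an orbit-bounded model of $T$. Let $\mathcal{J}$ be the core of $T$, $\iota:\mathcal{J}\to S(M)$ an embedding, and $\rho:S(M)\to\mathcal{J}$ a retraction (a homomorphism with $\rho\circ\iota=\mathrm{Id}_{\mathcal{J}}$). Then there exists a canonical (determined by $M,\iota,\rho$) quasi-homomorphism $\varphi:\mathrm{Aut}(M)\to(\mathcal{G}(T):\mathsf{Sh})$ such that: (1) When $C\subset\mathcal{G}(T)$ is precompact, $\varphi^{-1}(C)$ is bounded in $\mathrm{Aut}(M)$. (2) When $W\subset\mathrm{Aut}(M)$ is bounded, $\varphi(W)$ is precompact in $\mathcal{G}(T)$.
   Context: Local theories. Fix a first-order language $L$ with a sort $D$ (treated as the only sort) and a reflexive symmetric binary relation $m_1$ on $D$ in $L$. Let $d_m$ be the Cayley-graph distance of $m_1$; write $m_n(x,y)$ for $d_m(x,y)\le n$ and $m_n(a)=\{y:m_n(a,y)\}$ for the $n$-ball. Local formulas use only quantifiers of the form $(\exists x)(m_1(x,y)\wedge\cdots)$ and duals. A local theory $T$ is considered only through local models, i.e. structures satisfying $T$ in which any two elements of $D$ are at finite distance (elementary extensions are also local; elementarity is with respect to local formulas). $T$ is complete if it decides all sentences $(\forall x)\phi$, $(\exists x)\phi$ with $\phi$ local. $M$ is orbit-bounded (with bound $k$) if for all $a,b\in D(M)$ there is $\alpha\in\mathrm{Aut}(M)$ with $d_m(a,\alpha(b))\le k$. (DP): for each $r\in\mathbb{N}$ there is $m(r)\in\mathbb{N}$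 such that every $(r+1)$-ball is covered by at most $m(r)$ $r$-balls. Type spaces and pattern language. $S(M)$ is the set of complete $1$-types (of local formulas) over $M$ in sort $D$ realized in local elementary extensions of $M$. The pattern language $\mathcal{L}$ is relational, with equality; for each $t=(\phi_1(x_1,y),\ldots,\phi_n(x_n,y);\alpha(y))$ of local parameter-free $L$-formulas it has an $n$-ary relation $\mathsf{Def}_t$, interpreted in $S(M)$ by $\{(p_1,\ldots,p_n):(\forall a\in\alpha(M))\bigvee_{i}\phi_i(x,a)\in p_i\}$. Its locality relation is $\mu_1=\mathsf{Def}_t$ with $t=(\neg m_1(x_1,y_1),\neg m_1(x_2,y_2);\neg m_5(y_1,y_2))$, and local pp formulas are built from atomic formulas by conjunction and quantification $(\exists \xi)(\mu_1(\xi,\eta)\wedge\cdots)$. Core. The core $\mathcal{J}$ of $T$ is the unique (up to isomorphism) $\mathcal{L}$-structure such that for any orbit-bounded $N\models T$ there is an embedding $j:\mathcal{J}\to S(N)$, and for any such $j$ there is a homomorphism $r:S(N)\to\mathcal{J}$ with $r\circ j=\mathrm{Id}$. Give $\mathcal{J}$ the coarsest topology in which all sets definable by local pp formulas with parameters are closed; give $\mathrm{Aut}(\mathcal{J})$ the topology with pre-basic closed sets $\{g:R(ga_1,\ldots,ga_n,b_1,\ldots,b_m)\}$ ($R$ a local pp formula, $a_i,b_j\in\mathcal{J}$). Let $\mathfrak{g}=\{g\in\mathrm{Aut}(\mathcal{J}):gU\cap U\neq\emptyset\text{ for all nonempty open }U\subset\mathcal{J}\}$, a closed normal subgroup, and $\mathcal{G}(T)=\mathrm{Aut}(\mathcal{J})/\mathfrak{g}$,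 which is a locally compact (Hausdorff) topological group. The error set. A definable family of finite local partitions is a pair $(B,E)$ with $B$ a non-empty $0$-definable subset of $D^n$ ($n\ge1$) and $E(x,y;z_1,\ldots,z_n)\subset D^2\times B$ $0$-definable such that for some $f\in\mathbb{N}$ with $f>k$: $E$ implies $m_f(x,z_1)$ and $m_f(y,z_1)$; $B$ implies $m_f(z_1,z_i)$ for each $i$; and for each $b\in B$, $E(x,y;b)$ defines an equivalence relation on $m_f(b_1)$ with at most $f$ classes. Elements $a,a'\in D$ are Lascar–Shelah neighbors, $a\,\mathsf{Sh}\,a'$, if for every such $(B,E)$, $(\exists z)\,E(a,a',z)$ holds. Types $p_1,p_2\in S(N)$ are neighbors, $p_1\,\mathsf{Sh}\,p_2$, if there are realizations $a_i\models p_i$ (in an elementary extension) with $a_1\,\mathsf{Sh}\,a_2$; this relation is defined on $S(N)$ by a conjunction of atomic $\mathcal{L}$-formulas, and $\mathsf{Sh}$ is defined on $\mathcal{J}$ by the same conjunction (equivalently: $p\,\mathsf{Sh}\,q$ in $\mathcal{J}$ iff $j(p)\,\mathsf{Sh}\,j(q)$ for an embedding $j:\mathcal{J}\to S(N)$, $N$ orbit-bounded). Let $\mathsf{Sh}^{\mathrm{Aut}(\mathcal{J})}=\{g:g(a)\,\mathsf{Sh}\,a\ \forall a\in\mathcal{J}\}$, and let $\mathsf{Sh}\subset\mathcal{G}(T)$ denote its image in $\mathcal{G}(T)$; it is a conjugation-invariant, symmetric, compact subset. Other terms. A quasi-homomorphism $\phi:G\to(H:K)$, with $K\subset H$, is a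 map $\phi:G\to H$ with $\phi(1)=1$ and $\phi(xy^{-1})\in\phi(x)\phi(y^{-1})K$ for all $x,y\in G$. A subset is precompact if its closure is compact. $W\subset\mathrm{Aut}(M)$ is bounded if for some (equivalently all) $a\in D(M)$ the set $\{w(a):w\in W\}$ is contained in a $d_m$-ball of finite radius.
   Formalization: The stated embedding and retraction properties do not determine the core uniquely (infinite pure set, m_1 total: {∞} and {a,∞} both qualify), so the core is also required to have every endomorphism an automorphism; L is taken relational (functions as relations), and (DP) is assumed only for r≥1. *)

(* Defs.v *)
From HB Require Import structures.
From mathcomp Require Import all_boot finmap.
From mathcomp Require Import all_classical topology.

Set Implicit Arguments.
Unset Strict Implicit.
Unset Printing Implicit Defensive.

Local Open Scope classical_set_scope.
Local Open Scope quotient_scope.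

Record signature := Signature { sym : Type; arity : sym -> nat }.

(* Used both for structures in the base language L and for structures in the
   pattern language; equality is always interpreted as true equality. *)
Record rstruct (S : signature) := RStruct {
  carrier :> Type;
  interp : forall R : sym S, ('I_(arity R) -> carrier) -> Prop }.

Arguments interp {S r} R v.

Section Morphisms.
Context {S : signature}.
Implicit Types A B : rstruct S.

Definition homomorphism A B (f : A -> B) : Prop :=
  forall (R : sym S) (v : 'I_(arity R) -> A),
    interp R v -> interp R (fun i => f (v i)).

Definition embedding A B (f : A -> B) : Prop :=
  injective f /\
  forall (R : sym S) (v : 'I_(arity R) -> A),
    interp R v <-> interp R (fun i => f (v i)).

Record aut A := Aut {
  aut_fun :> A -> A;
  aut_inv : A -> A;
  aut_funK : cancel aut_fun aut_inv;
  aut_invK : cancel aut_inv aut_fun;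
  aut_interp : forall (R : sym S) (v : 'I_(arity R) -> A),
    interp R v <-> interp R (fun i => aut_fun (v i)) }.

Lemma aut_ext A (g h : aut A) : g =1 h -> g = h.
Proof.
case: g h => [g g' gK g'K gR] [h h' hK h'K hR] /= gh.
have egh : g = h by apply/funext.
have eg'h' : g' = h'.
  by apply/funext => x; apply: (can_inj gK); rewrite g'K egh h'K.
subst h h'.
by rewrite (Prop_irrelevance gK hK) (Prop_irrelevance g'K h'K)
  (Prop_irrelevance gR hR).
Qed.

Section Group.
Variable A : rstruct S.

Definition aut_id : aut A.
Proof. by exists id id. Defined.

Definition aut_comp (g h : aut A) : aut A.
Proof.
exists (fun x => g (h x)) (fun x => aut_inv h (aut_inv g x)) => [x|x|R v].
- by rewrite !aut_funK.
- by rewrite !aut_invK.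
- exact: (iff_trans (aut_interp h v) (aut_interp g _)).
Defined.

Definition aut_sym (g : aut A) : aut A.
Proof.
exists (aut_inv g) g => [||R v]; [exact: aut_invK|exact: aut_funK|].
apply: iff_sym; apply: iff_trans (aut_interp g _) _.
by rewrite (_ : (fun i => g (aut_inv g (v i))) = v) //;
  apply/funext => i; rewrite aut_invK.
Defined.

HB.instance Definition _ := gen_eqMixin (aut A).
HB.instance Definition _ := gen_choiceMixin (aut A).

Fact aut_compA : associative aut_comp.
Proof. by move=> f g h; apply: aut_ext. Qed.
Fact aut_comp1g : left_id aut_id aut_comp.
Proof. by move=> g; apply: aut_ext. Qed.
Fact aut_compg1 : right_id aut_id aut_comp.
Proof. by move=> g; apply: aut_ext. Qed.
Fact aut_compVg : left_inverse aut_id aut_sym aut_comp.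
Proof. by move=> g; apply: aut_ext => x /=; rewrite aut_funK. Qed.
Fact aut_compgV : right_inverse aut_id aut_sym aut_comp.
Proof. by move=> g; apply: aut_ext => x /=; rewrite aut_invK. Qed.

HB.instance Definition _ := isGroup.Build (aut A)
  aut_compA aut_comp1g aut_compg1 aut_compVg aut_compgV.

End Group.
End Morphisms.

(* A language lists the relation symbols other than m_1, which is added as the
   symbol None of arity 2.  Languages are relational, as is the pattern
   language: a term may leave every ball, so a function symbol would bring in
   an unbounded quantifier; functions are given by their graphs. *)
Record language := Language { lsym : Type; larity : lsym -> nat }.

Definition lsig (L : language) : signature :=
  @Signature (option (lsym L))
    (fun R => if R is Some R' then larity R' else 2).

Definition pair2 (X : Type) (x y : X) : 'I_2 -> X :=
  fun i => if i == ord0 then x else y.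

Definition scons (X : Type) n (x : X) (v : 'I_n -> X) : 'I_n.+1 -> X :=
  fun i => if unlift ord0 i is Some j then v j else x.

Definition m1 (L : language) (A : rstruct (lsig L)) (x y : A) : Prop :=
  interp (None : sym (lsig L)) (pair2 x y).

Record lstruct (L : language) := LStruct {
  lbase :> rstruct (lsig L);
  m1_refl : forall x : lbase, m1 x x;
  m1_sym : forall x y : lbase, m1 x y -> m1 y x;
  lstruct_inhabited : inhabited lbase }.

Section Logic.
Context {L : language}.
Implicit Types M N : lstruct L.

(* ball M n x y is m_n(x, y), that is d_m(x, y) <= n (m_1 is reflexive). *)
Fixpoint ball M (n : nat) (x y : M) : Prop :=
  if n is n'.+1 then exists z : M, m1 z x /\ ball n' z y else x = y.

Definition local_structure M : Prop :=
  forall x y : M, exists n, ball n x y.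

(* Local formulas in the variables x_0, ..., x_(n-1).  FEx i phi is
   (exists z)(m_1(z, x_i) /\ phi(z, x_0, ..., x_(n-1))): in phi the bound
   variable is number 0 and x_j is number lift ord0 j. *)
Inductive formula : nat -> Type :=
| FFalse n : formula n
| FEq n (i j : 'I_n) : formula n
| FRel n (R : sym (lsig L)) (s : 'I_(arity R) -> 'I_n) : formula n
| FNot n (phi : formula n) : formula n
| FAnd n (phi psi : formula n) : formula n
| FEx n (i : 'I_n) (phi : formula n.+1) : formula n.

Fixpoint sat M n (phi : formula n) : ('I_n -> M) -> Prop :=
  match phi in formula n return ('I_n -> M) -> Prop with
  | FFalse _ => fun=> False
  | FEq _ i j => fun v => v i = v j
  | FRel _ R s => fun v => interp R (fun k => v (s k))
  | FNot _ phi => fun v => ~ sat phi v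
  | FAnd _ phi psi => fun v => sat phi v /\ sat psi v
  | FEx _ i phi => fun v => exists z : M, m1 z (v i) /\ sat phi (scons z v)
  end.

Definition FM1 n (i j : 'I_n) : formula n :=
  @FRel n None (pair2 i j).

(* The local formula m_k(x_i, x_j). *)
Fixpoint FBall (k n : nat) (i j : 'I_n) : formula n :=
  if k is k'.+1 then FEx i (FBall k' ord0 (lift ord0 j)) else FEq i j.

(* The quantifiers bind the whole tuple x_0, ..., x_(n-1), without bound. *)
Inductive sentence :=
| SAll n (phi : formula n)
| SEx n (phi : formula n).

Definition holds M (s : sentence) : Prop :=
  match s with
  | SAll _ phi => forall v, sat (M := M) phi v
  | SEx _ phi => exists v, sat (M := M) phi v
  end.

Definition theory := set sentence.

Definition model (T : theory) M : Prop :=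
  local_structure M /\ forall s, T s -> holds M s.

Definition complete_theory (T : theory) : Prop :=
  forall s, (forall N, model T N -> holds N s) \/
            (forall N, model T N -> ~ holds N s).

(* (DP).  The 0-balls are points, so r = 0 would say that the 1-balls are
   finite; the scales are r >= 1. *)
Definition doubling (T : theory) : Prop :=
  forall r, (0 < r)%N -> exists m : nat, forall N, model T N ->
    forall x : N, exists c : 'I_m -> N,
      forall y, ball r.+1 x y -> exists i, ball r (c i) y.

Definition orbit_bounded (k : nat) M : Prop :=
  forall a b : M, exists g : aut M, ball k a (g b).

Definition bounded M (W : set (aut M)) : Prop :=
  exists a c : M, exists n : nat, forall w, W w -> ball n c (w a).

Definition elementary M N (f : M -> N) : Prop :=
  local_structure N /\
  forall n (phi : formula n) (v : 'I_n -> M),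
    sat phi v <-> sat phi (fun i => f (v i)).

(* A set of formulas phi(x, a) with parameters a in M; x is variable 0. *)
Definition pretype M := forall n, formula n.+1 -> ('I_n -> M) -> Prop.

Definition realizes M N (f : M -> N) (c : N) (p : pretype M) : Prop :=
  forall n (phi : formula n.+1) (a : 'I_n -> M),
    p n phi a <-> sat phi (scons c (fun i => f (a i))).

Definition is_type M (p : pretype M) : Prop :=
  exists N, exists f : M -> N, elementary f /\ exists c : N, realizes f c p.

Record ltype M := LType { type_of : pretype M; ltypeP : is_type type_of }.

(* t = (phi_1(x_1, y), ..., phi_n(x_n, y); alpha(y)); in each phi_i, x_i is
   variable 0. *)
Record pattern := Pattern {
  pat_size : nat;
  pat_vars : nat;
  pat_form : 'I_pat_size -> formula pat_vars.+1;
  pat_dom : formula pat_vars }.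

Definition psig : signature := Signature pat_size.

Definition type_space M : rstruct psig :=
  @RStruct psig (ltype M)
    (fun (t : pattern) (p : 'I_(pat_size t) -> ltype M) =>
       forall a : 'I_(pat_vars t) -> M, sat (pat_dom t) a ->
         exists i, type_of (p i) (pat_form i) a).

(* (~ m_1(x_1, y_1), ~ m_1(x_2, y_2); ~ m_5(y_1, y_2)) *)
Definition mu_pattern : pattern :=
  @Pattern 2 2 (fun i => FNot (FM1 ord0 (lift ord0 i)))
    (FNot (FBall 5 ord0 (lift ord0 ord0))).

Definition mu1 (A : rstruct psig) (x y : A) : Prop :=
  interp (mu_pattern : sym psig) (pair2 x y).

(* Local pp formulas in n variables; variables are handled as in formula. *)
Inductive ppformula : nat -> Type :=
| PPEq n (i j : 'I_n) : ppformula n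
| PPDef n (t : pattern) (s : 'I_(pat_size t) -> 'I_n) : ppformula n
| PPAnd n (phi psi : ppformula n) : ppformula n
| PPEx n (i : 'I_n) (phi : ppformula n.+1) : ppformula n.

Fixpoint ppsat (A : rstruct psig) n (phi : ppformula n) : ('I_n -> A) -> Prop :=
  match phi in ppformula n return ('I_n -> A) -> Prop with
  | PPEq _ i j => fun v => v i = v j
  | PPDef _ t s => fun v => interp (t : sym psig) (fun k => v (s k))
  | PPAnd _ phi psi => fun v => ppsat phi v /\ ppsat psi v
  | PPEx _ i phi => fun v =>
      exists x : A, mu1 x (v i) /\ ppsat phi (scons x v)
  end.

Lemma sat_aut M (g : aut M) n (phi : formula n) (v : 'I_n -> M) :
  sat phi v <-> sat phi (fun i => g (v i)).
Proof.
have scons_aut k x (w : 'I_k -> M) :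
    scons (g x) (fun i => g (w i)) = fun i => g (scons x w i).
  by apply/funext => i; rewrite /scons; case: (unlift ord0 i).
have m1_aut x y : m1 x y <-> m1 (g x) (g y).
  rewrite /m1; apply: iff_trans (aut_interp g _) _.
  rewrite (_ : (fun i => _) = pair2 (g x) (g y)) //.
  by apply/funext => i; rewrite /pair2; case: ifP.
elim: phi v => {n} [n v|n i j v|n R s v|n phi IH v|n phi IH psi IH' v|
  n i phi IH v] /=.
- by [].
- by split=> [->|/(can_inj (aut_funK g))].
- exact: aut_interp.
- by rewrite IH.
- by rewrite IH IH'.
- split=> -[z [zi zphi]].
    exists (g z); split; first exact: (m1_aut _ _).1 zi.
    by rewrite scons_aut; exact: (IH _).1 zphi.
  exists (aut_inv g z); split; first by apply: (m1_aut _ _).2; rewrite aut_invK.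
  by apply: (IH _).2; rewrite -scons_aut aut_invK.
Qed.

Definition pretype_act M (g : aut M) (p : pretype M) : pretype M :=
  fun n phi a => p n phi (fun i => aut_inv g (a i)).

Fact is_type_act M (g : aut M) (p : ltype M) :
  is_type (pretype_act g (type_of p)).
Proof.
have [N [f [[locN elf] [c cp]]]] := ltypeP p.
exists N, (fun x => f (aut_inv g x)); split; last first.
  by exists c => n phi a; apply: cp.
by split=> // n phi v; rewrite (sat_aut (aut_sym g) phi v); apply: elf.
Qed.

Definition type_act M (g : aut M) (p : type_space M) : type_space M :=
  LType (is_type_act g p).

(* The last clause is the minimality that makes the core unique up to
   isomorphism.  Without it the first two do not determine J: when D is an
   infinite set with m_1 everywhere true they hold for the structure with the
   non-realized type alone, and for the one with a realized type added. *)
Record is_core (T : theory) (J : rstruct psig) : Prop := IsCore {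
  core_embeds : forall N, model T N -> (exists k, orbit_bounded k N) ->
    exists j : J -> type_space N, embedding j;
  core_retract : forall N, model T N -> (exists k, orbit_bounded k N) ->
    forall j : J -> type_space N, embedding j ->
    exists r : type_space N -> J, homomorphism r /\ cancel j r;
  core_endo : forall f : J -> J, homomorphism f ->
    exists g : aut J, forall x, f x = g x }.

(* (B, E) is a definable family of finite local partitions.  The variables of
   B are z_1, ..., z_(n+1); those of E are x, y, z_1, ..., z_(n+1). *)
Definition finite_local_partitions (k : nat) N n
    (B : formula n.+1) (E : formula n.+3) : Prop :=
  let onB (z : 'I_n.+1 -> N) := sat B z in
  let rE (z : 'I_n.+1 -> N) (x y : N) := sat E (scons x (scons y z)) in
  (exists z, onB z) /\
  exists f : nat, [/\ (k < f)%N,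
    forall z x y, rE z x y ->
      [/\ onB z, ball f x (z ord0) & ball f y (z ord0)],
    forall z, onB z -> forall i, ball f (z ord0) (z i) &
    forall z, onB z ->
      [/\ forall x, ball f (z ord0) x -> rE z x x,
          forall x y, rE z x y -> rE z y x,
          forall x y w, rE z x y -> rE z y w -> rE z x w &
          exists c : 'I_f -> N,
            forall x, ball f (z ord0) x -> exists i, rE z x (c i)]].

Definition sh_elt (k : nat) N (a a' : N) : Prop :=
  forall n (B : formula n.+1) (E : formula n.+3),
    finite_local_partitions k N B E ->
    exists z : 'I_n.+1 -> N, sat E (scons a (scons a' z)).

Definition sh_type (k : nat) M (p1 p2 : ltype M) : Prop :=
  exists N, exists f : M -> N, elementary f /\
    exists a1 a2 : N,
      [/\ realizes f a1 (type_of p1), realizes f a2 (type_of p2) & sh_elt k a1 a2].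

Definition sh_core (T : theory) (k : nat) (J : rstruct psig) (p q : J) : Prop :=
  exists N, [/\ model T N, exists k', orbit_bounded k' N &
    exists j : J -> type_space N, embedding j /\ sh_type k (j p) (j q)].

End Logic.

Arguments formula : clear implicits.
Arguments ppformula : clear implicits.
Arguments sentence : clear implicits.
Arguments theory : clear implicits.
Arguments pattern : clear implicits.
Arguments psig : clear implicits.

Definition core_space L (J : rstruct (psig L)) : Type := J.

Section CoreSpace.
Variables (L : language) (J : rstruct (psig L)).

(* Complements of the sets defined by local pp formulas with parameters. *)
Definition core_subbase : set (set (core_space J)) :=
  [set U | exists n (R : ppformula L n.+1) (b : 'I_n -> J),
     U = [set p | ~ ppsat R (scons p b)]].

HB.instance Definition _ := gen_eqMixin (core_space J).
HB.instance Definition _ := gen_choiceMixin (core_space J).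
HB.instance Definition _ :=
  isSubBaseTopological.Build (core_space J) core_subbase id.

End CoreSpace.

Definition core_aut L (J : rstruct (psig L)) : Type := aut J.

Section CoreAut.
Variables (L : language) (J : rstruct (psig L)).

HB.instance Definition _ := Group.on (core_aut J).

(* Complements of the sets {g : R(g a_1, ..., g a_n, b_1, ..., b_m)}. *)
Definition core_aut_subbase : set (set (core_aut J)) :=
  [set U | exists n m (R : ppformula L (n + m)) (a : 'I_n -> J)
     (b : 'I_m -> J),
     U = [set g : core_aut J | ~ ppsat R (fun i =>
            match fintype.split i with inl i1 => aut_fun g (a i1) | inr i2 => b i2 end)]].

HB.instance Definition _ :=
  isSubBaseTopological.Build (core_aut J) core_aut_subbase id.

Local Open Scope group_scope.

Lemma ppsat_aut (g : aut J) n (R : ppformula L n) (v : 'I_n -> J) :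
  ppsat R v <-> ppsat R (fun i => g (v i)).
Proof.
have scons_aut k x (w : 'I_k -> J) :
    scons (g x) (fun i => g (w i)) = fun i => g (scons x w i).
  by apply/funext => i; rewrite /scons; case: (unlift ord0 i).
have mu1_aut x y : mu1 x y <-> mu1 (g x) (g y).
  rewrite /mu1; apply: iff_trans (aut_interp g _) _.
  rewrite (_ : (fun i => _) = pair2 (g x) (g y)) //.
  by apply/funext => i; rewrite /pair2; case: ifP.
elim: R v => {n} [n i j v|n R s v|n phi IH psi IH' v|n i phi IH v] /=.
- by split=> [->|/(can_inj (aut_funK g))].
- exact: aut_interp.
- by rewrite IH IH'.
- split=> -[z [zi zphi]].
    exists (g z); split; first exact: (mu1_aut _ _).1 zi.
    by rewrite scons_aut; exact: (IH _).1 zphi.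
  exists (aut_inv g z); split.
    by apply: (mu1_aut _ _).2; rewrite aut_invK.
  by apply: (IH _).2; rewrite -scons_aut aut_invK.
Qed.

Lemma core_aut_continuous (g : aut J) :
  continuous (g : core_space J -> core_space J).
Proof.
apply/continuousP => A [D' D'sub <-]; rewrite preimage_bigcup.
apply: bigcup_open => B /D'sub [F Fsub <-]; rewrite preimage_bigcap.
rewrite bigcap_fset big_seq; elim/big_ind: _ => [|U V|U /Fsub/set_mem];
  [exact: openT|exact: openI|move=> [n [R [b ->]]]].
pose V : set (core_space J) :=
  [set p | ~ ppsat R (scons p (fun i => aut_inv g (b i)))].
rewrite (_ : _ @^-1` _ = V).
  exists [set V]; last by rewrite bigcup_set1.
  move=> _ ->; exists [fset V]%fset; last by rewrite set_fset1 bigcap_set1.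
  move=> W /fset1P ->; apply/mem_set.
  by exists n, R, (fun i => aut_inv g (b i)).
apply/funext => p; rewrite /V /preimage /=; apply/propext.
have -> : scons (g p) b = fun i => g (scons p (fun i => aut_inv g (b i)) i).
  apply/funext => i; rewrite /scons; case: (unlift ord0 i) => [j|//].
  by rewrite aut_invK.
by rewrite -ppsat_aut.
Qed.

Lemma core_aut_open (g : aut J) (U : set (core_space J)) :
  open U -> open (g @` U : set (core_space J)).
Proof.
move=> oU; rewrite (_ : g @` U = aut_inv g @^-1` U).
  by move: (@core_aut_continuous (aut_sym g)) => /continuousP; apply.
rewrite eqEsubset; split=> [_ [x Ux <-]|x Ux] /=; first by rewrite aut_funK.
by exists (aut_inv g x); rewrite ?aut_invK.
Qed.

Definition frakg : set (core_aut J) :=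
  [set g | forall U : set (core_space J), open U -> U !=set0 ->
     ((aut_fun g @` U) `&` U) !=set0].

Lemma frakg1 : frakg 1.
Proof. by move=> U _ [x Ux]; exists x; split=> //; exists x. Qed.

Lemma frakgM g h : frakg g -> frakg h -> frakg (g * h).
Proof.
move=> fg fh U oU U0.
have [|_ [[_ [[y Uy <-] Uhy] <-] [_ Ugx]]] :=
  fg (aut_fun h @` U `&` U) _ (fh U oU U0).
  by apply: openI => //; apply: core_aut_open.
by exists (aut_fun g (aut_fun h y)); split=> //; exists y.
Qed.

Lemma frakgV g : frakg g -> frakg g^-1.
Proof.
move=> fg U oU U0; have [_ [[x Ux <-] Ugx]] := fg U oU U0.
by exists x; split=> //; exists (aut_fun g x) => //=; rewrite aut_funK.
Qed.

Lemma frakgJ g h : frakg g -> frakg (g ^ h).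
Proof.
move=> fg U oU [u Uu].
have [||_ [[_ [x Ux <-] <-] [y Uy ygx]]] := fg (aut_fun h @` U).
- exact: core_aut_open.
- by exists (aut_fun h u); exists u.
exists y; split=> //; exists x => //=.
by rewrite -ygx aut_funK.
Qed.

Definition frakg_eq (g h : core_aut J) : bool := `[< frakg (g^-1 * h) >].

Fact frakg_eq_refl : reflexive frakg_eq.
Proof. by move=> g; apply/asboolP; rewrite mulVg; apply: frakg1. Qed.

Fact frakg_eq_sym : symmetric frakg_eq.
Proof.
by move=> g h; apply/asboolP/asboolP => /frakgV; rewrite invgM invgK.
Qed.

Fact frakg_eq_trans : transitive frakg_eq.
Proof.
move=> h g k /asboolP gh /asboolP hk; apply/asboolP.
by have := frakgM gh hk; rewrite mulgA -(mulgA g^-1) mulgV mulg1.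
Qed.

Canonical frakg_equiv :=
  EquivRel frakg_eq frakg_eq_refl frakg_eq_sym frakg_eq_trans.

(* G(T) = Aut(J) / frakg, with the quotient topology. *)
Definition calG : Type := quotient_topology {eq_quot frakg_equiv}.

HB.instance Definition _ := Topological.on calG.
HB.instance Definition _ := Quotient.on calG.

Definition calG_proj (g : core_aut J) : calG := \pi_calG g.

Lemma calG_projP g h : frakg (g^-1 * h) <-> calG_proj g = calG_proj h.
Proof.
split=> [gh|/eqmodP/asboolP//].
by apply/eqmodP/asboolP.
Qed.

Definition calG_mul (a b : calG) : calG := calG_proj (repr a * repr b).
Definition calG_inv (a : calG) : calG := calG_proj (repr a)^-1.

Lemma calG_mulE g h : calG_mul (calG_proj g) (calG_proj h) = calG_proj (g * h).
Proof.
have /calG_projP := reprK (calG_proj g); have /calG_projP := reprK (calG_proj h).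
rewrite /calG_mul; set g' := repr (calG_proj g); set h' := repr (calG_proj h) => h'h g'g.
apply/calG_projP; have := frakgM (frakgJ h' g'g) h'h.
by congr frakg; rewrite /conjg invgM !mulgA mulgK.
Qed.

Lemma calG_invE g : calG_inv (calG_proj g) = calG_proj g^-1.
Proof.
have /calG_projP := reprK (calG_proj g).
rewrite /calG_inv; set g' := repr _ => g'g.
apply/calG_projP; have := frakgJ g'^-1 (frakgV g'g).
by congr frakg; rewrite /conjg invgM !invgK !mulgA mulgK.
Qed.

Lemma calG_ind (P : calG -> Prop) : (forall g, P (calG_proj g)) -> forall a, P a.
Proof. by move=> Pg a; rewrite -(reprK a); apply: Pg. Qed.

Fact calG_mulA : associative calG_mul.
Proof.
by elim/calG_ind=> g; elim/calG_ind=> h; elim/calG_ind=> k;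
  rewrite !calG_mulE mulgA.
Qed.
Fact calG_mul1g : left_id (calG_proj 1) calG_mul.
Proof. by elim/calG_ind=> g; rewrite calG_mulE mul1g. Qed.
Fact calG_mulg1 : right_id (calG_proj 1) calG_mul.
Proof. by elim/calG_ind=> g; rewrite calG_mulE mulg1. Qed.
Fact calG_mulVg : left_inverse (calG_proj 1) calG_inv calG_mul.
Proof. by elim/calG_ind=> g; rewrite calG_invE calG_mulE mulVg. Qed.
Fact calG_mulgV : right_inverse (calG_proj 1) calG_inv calG_mul.
Proof. by elim/calG_ind=> g; rewrite calG_invE calG_mulE mulgV. Qed.

HB.instance Definition _ := isGroup.Build calG
  calG_mulA calG_mul1g calG_mulg1 calG_mulVg calG_mulgV.

(* The image in G(T) of {g : g(a) Sh a for all a in J}. *)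
Definition sh_set (T : theory L) (k : nat) : set calG :=
  calG_proj @` [set g : core_aut J |
    forall a : J, sh_core T k (aut_fun g a) a].

End CoreAut.

(* phi : G -> (H : K). *)
Definition quasi_hom (G H : groupType) (K : set H) (phi : G -> H) : Prop :=
  phi 1%g = 1%g /\
  forall x y : G, exists2 c : H, K c &
    phi (x * y^-1)%g = (phi x * phi (y^-1) * c)%g.

(* phi is the map g |-> class of rho o g o iota; this is what makes it
   determined by M, iota and rho. *)
Definition canonical_map L (M : lstruct L) (J : rstruct (psig L))
    (iota : J -> type_space M) (rho : type_space M -> J)
    (phi : aut M -> calG J) : Prop :=
  forall g : aut M, exists u : aut J,
    (forall p : J, u p = rho (type_act g (iota p))) /\ phi g = calG_proj u.

(* Main.v *)
From Stdlib Require List.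
Require Import Defs.
From HB Require Import structures.
From mathcomp Require Import all_boot finmap.
From mathcomp Require Import all_classical topology.

Set Implicit Arguments.
Unset Strict Implicit.
Unset Printing Implicit Defensive.

Local Open Scope classical_set_scope.
Local Notation ball := Defs.ball.

(* Put h = iota o rho, an idempotent endomorphism of S(M), and let phi g be the
   class of u_g = rho o g o iota, which is an automorphism of J because every
   endomorphism of the core is.

   Quasi-homomorphism: for (B, E) a family of finite local partitions and p in
   S(M), some class of some E_b contains both p and h p, since otherwise the
   pattern (~ E, ~ E) would hold at (p, h p), hence at (h p, h p).  So p and h p
   are neighbours, and u_xy = rho x y iota and u_x u_y = rho x h y iota differ by
   an element of Sh because homomorphisms preserve the neighbour relation.

   Boundedness: by doubling, every type over M lies in the 1-ball of a point of M,
   so that distances in S(M), and in J through iota, are controlled by the atomic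
   relations neard (closed) and ~ fard (open).  Bounded sets of automorphisms of J
   are compact: an ultrafilter on such a set has a limit type at each point, which
   gives a homomorphism f : J -> S(M), and it converges to rho o f.  As frakg
   is itself bounded, both claims descend to the quotient. *)

(** * Local formulas *)

Section Tuples.
Variables (X : Type) (n : nat).
Implicit Types (x : X) (v : 'I_n -> X).

Lemma scons0 x v : scons x v ord0 = x.
Proof. by rewrite /scons unlift_none. Qed.

Lemma sconsS x v i : scons x v (lift ord0 i) = v i.
Proof. by rewrite /scons liftK. Qed.

(** The body copies the tuple in [core_aut_subbase], so that the tuples occurring there are
    instances of [vcat] by conversion. *)
Definition vcat m (z : 'I_m -> X) v : 'I_(m + n) -> X := fun i =>
  match fintype.split i with inl j => z j | inr j => v j end.

Lemma vcatl m (z : 'I_m -> X) v i : vcat z v (lshift n i) = z i.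
Proof. by rewrite /vcat (unsplitK (inl i)). Qed.

Lemma vcatr m (z : 'I_m -> X) v i : vcat z v (rshift m i) = v i.
Proof. by rewrite /vcat (unsplitK (inr i)). Qed.

Lemma vcat0 (z : 'I_0 -> X) v : vcat z v = v.
Proof.
apply/funext => i; rewrite -(vcatr z v i); congr (vcat z v _); exact: val_inj.
Qed.

End Tuples.

Lemma ord_ind n (P : 'I_n.+1 -> Prop) :
  P ord0 -> (forall i : 'I_n, P (lift ord0 i)) -> forall i, P i.
Proof. by move=> P0 PS i; case: (unliftP ord0 i) => [j ->|->]. Qed.

Lemma scons_comp (X Y : Type) (h : X -> Y) n (x : X) (v : 'I_n -> X) :
  (fun i => h (scons x v i)) = scons (h x) (fun i => h (v i)).
Proof.
by apply/funext; apply: ord_ind => [|i]; rewrite ?scons0 ?sconsS.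
Qed.

Lemma scons_eta (X : Type) n (v : 'I_n.+1 -> X) :
  scons (v ord0) (fun i => v (lift ord0 i)) = v.
Proof.
by apply/funext; apply: ord_ind => [|i]; rewrite ?scons0 ?sconsS.
Qed.

Lemma vcat_comp (X Y : Type) (h : X -> Y) m n (z : 'I_m -> X) (v : 'I_n -> X) :
  (fun i => h (vcat z v i)) = vcat (fun i => h (z i)) (fun i => h (v i)).
Proof. by apply/funext => i; rewrite /vcat; case: (fintype.split i). Qed.

(** Well typed because [m.+1 + n] and [(m + n).+1] are convertible; this lets [FExT] bind a block
    one variable at a time. *)
Lemma vcat_scons (X : Type) m n (x : X) (z : 'I_m -> X) (v : 'I_n -> X) :
  @scons _ (m + n) x (vcat z v) = @vcat _ n m.+1 (scons x z) v.
Proof.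
apply/funext => i; rewrite -(@splitK m.+1 n i).
case: (@fintype.split m.+1 n i) => [j|j] /=.
  rewrite vcatl; move: j; apply: ord_ind => [|j].
    have -> : @lshift m.+1 n ord0 = @ord0 (m + n) by apply: val_inj.
    by rewrite !scons0.
  have -> : @lshift m.+1 n (lift ord0 j) = @lift (m + n).+1 ord0 (lshift n j).
    exact: val_inj.
  by rewrite !sconsS vcatl.
rewrite vcatr.
have -> : @rshift m.+1 n j = @lift (m + n).+1 ord0 (rshift m j).
  exact: val_inj.
by rewrite sconsS vcatr.
Qed.

Lemma pair2_comp (X Y : Type) (h : X -> Y) x y :
  (fun i => h (pair2 x y i)) = pair2 (h x) (h y).
Proof. by apply/funext => i; rewrite /pair2; case: ifP. Qed.

Lemma pair2l (X : Type) (x y : X) : pair2 x y ord0 = x.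
Proof. by []. Qed.

Lemma pair2r (X : Type) (x y : X) : pair2 x y (lift ord0 ord0) = y.
Proof. by []. Qed.

Section Balls.
Context {L : language}.
Implicit Types N : lstruct L.

Lemma ball1 N (x y : N) : ball 1 x y <-> m1 x y.
Proof.
split=> [[z [/m1_sym zx <-]] //|xy]; exists y; split=> //; exact: m1_sym.
Qed.

Lemma ball_refl N n (x : N) : ball n x x.
Proof. by elim: n => [//|n IH]; exists x; split=> //; apply: m1_refl. Qed.

Lemma ball_trans N n m (x y z : N) : ball n x y -> ball m y z -> ball (n + m) x z.
Proof.
elim: n x => [|n IH] x; first by move=> ->.
by case=> w [wx wy] yz; exists w; split=> //; apply: IH yz.
Qed.

Lemma ball_sym N n (x y : N) : ball n x y -> ball n y x.
Proof.
elim: n x => [|n IH] x; first by move=> ->.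
case=> w [wx /IH yw]; rewrite -addn1; apply: ball_trans yw _.
exact/ball1.
Qed.

Lemma ball_le N n m (x y : N) : (n <= m)%N -> ball n x y -> ball m x y.
Proof.
move=> /subnKC <- xy; apply: ball_trans xy _; exact: ball_refl.
Qed.

Lemma ball_aut N (g : aut N) n (x y : N) : ball n x y <-> ball n (g x) (g y).
Proof.
have m1g (a b : N) : m1 a b <-> m1 (g a) (g b).
  by rewrite /m1 (aut_interp g) pair2_comp.
elim: n x => [|n IH] x /=.
  by split=> [->|/(can_inj (aut_funK g))].
split=> -[z [zx zy]].
  by exists (g z); split; [exact: (m1g _ _).1|exact: (IH _).1].
exists (aut_inv g z); split; first by apply: (m1g _ _).2; rewrite aut_invK.
by apply: (IH _).2; rewrite aut_invK.
Qed.

Lemma sat_FM1 N n i j (v : 'I_n -> N) : sat (FM1 i j) v <-> m1 (v i) (v j).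
Proof. by rewrite /= /m1 pair2_comp. Qed.

Lemma sat_FBall N k n i j (v : 'I_n -> N) :
  sat (FBall k i j) v <-> ball k (v i) (v j).
Proof.
elim: k n i j v => [|k IH] n i j v //=.
by split=> -[z [zi bz]]; exists z; split=> //;
  move: bz; rewrite IH scons0 sconsS.
Qed.

End Balls.

(** * Substitution, bounded quantifiers and finite conjunctions *)

Section FormulaConstructions.
Context {L : language}.
Implicit Types N : lstruct L.

Definition FTrue n : formula L n := FNot (FFalse n).

Lemma sat_FAnd N n (phi psi : formula L n) (v : 'I_n -> N) :
  sat (FAnd phi psi) v <-> sat phi v /\ sat psi v.
Proof. by []. Qed.

Fixpoint FSubst n (phi : formula L n) : forall m, ('I_n -> 'I_m) -> formula L m :=
  match phi in formula _ n return forall m, ('I_n -> 'I_m) -> formula L m with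
  | FFalse _ => fun m s => FFalse m
  | FEq _ i j => fun m s => FEq (s i) (s j)
  | FRel _ R t => fun m s => FRel (fun k => s (t k))
  | FNot _ phi => fun m s => FNot (FSubst phi s)
  | FAnd _ phi psi => fun m s => FAnd (FSubst phi s) (FSubst psi s)
  | FEx _ i phi => fun m s =>
      FEx (s i) (FSubst phi (scons ord0 (fun j => lift ord0 (s j))))
  end.

Lemma sat_FSubst N n (phi : formula L n) m (s : 'I_n -> 'I_m) (v : 'I_m -> N) :
  sat (FSubst phi s) v <-> sat phi (fun i => v (s i)).
Proof.
elim: phi m s v => {n} [n|n i j|n R t|n phi IH|n phi IH psi IH'|n i phi IH] m s v //=.
- by rewrite IH.
- by rewrite IH IH'.
- have scE z : (fun i => scons z v (scons ord0 (fun j => lift ord0 (s j)) i)) =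
      scons z (fun i => v (s i)).
    by rewrite scons_comp scons0; congr scons; apply/funext => k; rewrite sconsS.
  by split=> -[z [zi sz]]; exists z; split=> //; move: sz; rewrite IH scE.
Qed.

(* exists z in m_l(x_i), phi(z, x) *)
Fixpoint FExB l : forall n, 'I_n -> formula L n.+1 -> formula L n :=
  if l is l'.+1 then fun n i phi =>
    FEx i (FExB l' ord0 (FSubst phi (scons ord0 (fun j => lift ord0 (lift ord0 j)))))
  else fun n i phi => FSubst phi (scons i id).

Lemma sat_FExB N l n (i : 'I_n) (phi : formula L n.+1) (v : 'I_n -> N) :
  sat (FExB l i phi) v <-> exists z, ball l (v i) z /\ sat phi (scons z v).
Proof.
elim: l n i phi v => [|l IH] n i phi v /=.
  rewrite sat_FSubst scons_comp.
  by split=> [sz|[z [<- //]]]; exists (v i).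
have scE w z : (fun j => scons z (scons w v)
    (scons ord0 (fun j => lift ord0 (lift ord0 j)) j)) = scons z v.
  by rewrite scons_comp scons0; congr scons; apply/funext => k; rewrite !sconsS.
split=> [[w [wi]]|[z [[w [wi wz]] sz]]].
  move/IH => [z [wz]]; rewrite sat_FSubst scE => sz; exists z; split=> //.
  by exists w; split=> //; rewrite scons0 in wz.
exists w; split=> //; apply/IH; exists z; split; first by rewrite scons0.
by rewrite sat_FSubst scE.
Qed.

(** Local formulas have no unbounded quantifiers, so every variable of the block is kept in the
    [l]-ball of one free variable. *)
Fixpoint FExT l n (j : 'I_n) m : formula L (m + n) -> formula L n :=
  match m return formula L (m + n) -> formula L n with
  | 0 => id
  | m'.+1 => fun phi => FExT l j (FExB l (rshift m' j) phi)
  end.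

Lemma sat_FExT N l n (j : 'I_n) m (phi : formula L (m + n)) (v : 'I_n -> N) :
  sat (FExT l j phi) v <->
  exists z : 'I_m -> N, (forall i, ball l (v j) (z i)) /\ sat phi (vcat z v).
Proof.
elim: m phi => [|m IH] phi /=.
  split=> [sv|[z [_]]]; last by rewrite vcat0.
  by exists (fun i : 'I_0 => v j); rewrite vcat0; split=> // -[].
rewrite IH; split=> -[z [bz]].
  move/sat_FExB => [x [bx sx]]; exists (scons x z); rewrite -vcat_scons.
  split=> //; apply: ord_ind => [|i]; rewrite ?scons0 ?sconsS //.
  by rewrite vcatr in bx.
move=> sz; exists (fun i => z (lift ord0 i)); split=> //.
apply/sat_FExB; exists (z ord0); split; first by rewrite vcatr.
by rewrite vcat_scons scons_eta.
Qed.

Fixpoint FAll n (m : nat) : ('I_m -> formula L n) -> formula L n :=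
  match m return ('I_m -> formula L n) -> formula L n with
  | 0 => fun _ => FTrue n
  | m'.+1 => fun phi => FAnd (phi ord0) (FAll (fun i => phi (lift ord0 i)))
  end.

Lemma sat_FAll N n m (phi : 'I_m -> formula L n) (v : 'I_n -> N) :
  sat (FAll phi) v <-> forall i, sat (phi i) v.
Proof.
elim: m phi => [|m IH] phi /=; first by split=> // _ [].
rewrite IH; split=> [[s0 sS]|s]; first by apply: ord_ind.
by split.
Qed.

(* phi(x, y) /\ psi(x, z) *)
Definition FMerge m n (phi : formula L m.+1) (psi : formula L n.+1) :
    formula L (m + n).+1 :=
  FAnd (FSubst phi (scons ord0 (fun i => lift ord0 (lshift n i))))
       (FSubst psi (scons ord0 (fun i => lift ord0 (rshift m i)))).

Lemma sat_FMerge N m n (phi : formula L m.+1) (psi : formula L n.+1)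
    (x : N) (a : 'I_m -> N) (b : 'I_n -> N) :
  sat (FMerge phi psi) (scons x (vcat a b)) <->
  sat phi (scons x a) /\ sat psi (scons x b).
Proof.
rewrite /= !sat_FSubst !scons_comp !scons0.
rewrite (_ : (fun i => _) = a); last first.
  by apply/funext => i; rewrite sconsS vcatl.
rewrite (_ : (fun i => _) = b) //.
by apply/funext => i; rewrite sconsS vcatr.
Qed.

End FormulaConstructions.

(** * Transfer along elementary maps *)

Section Elementary.
Context {L : language} {M N : lstruct L} (f : M -> N) (ef : elementary f).

Lemma elem_sat n (phi : formula L n) (v : 'I_n -> M) :
  sat phi (fun i => f (v i)) <-> sat phi v.
Proof. by rewrite (ef.2 n phi v). Qed.

Lemma elem_ball n (x y : M) : ball n (f x) (f y) <-> ball n x y.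
Proof.
have := elem_sat (FBall n ord0 (lift ord0 ord0)) (pair2 x y).
by rewrite !sat_FBall.
Qed.

(** A Tarski-Vaught step: the existential, being bounded, is itself a local formula and so descends
    to [M]. *)
Lemma elem_exb n l (i : 'I_n) (phi : formula L n.+1) (v : 'I_n -> M) (y : N) :
  ball l (f (v i)) y -> sat phi (scons y (fun i => f (v i))) ->
  exists x, ball l (v i) x /\ sat phi (scons x v).
Proof.
move=> by_ sy; apply/sat_FExB/elem_sat/sat_FExB; by exists y.
Qed.

(** A finite definable cover of a ball survives in [N]: an uncovered point would satisfy the
    conjunction of the negations, and [elem_exb] would produce one in [M]. *)
Lemma elem_cover n l (j : 'I_n) m (phi : 'I_m -> formula L n.+1) (v : 'I_n -> M) :
  (forall x, ball l (v j) x -> exists i, sat (phi i) (scons x v)) ->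
  forall y, ball l (f (v j)) y ->
    exists i, sat (phi i) (scons y (fun i => f (v i))).
Proof.
move=> cov y byy; apply: contrapT => ncov.
have [|x [bx]] := @elem_exb _ l j (FAll (fun i => FNot (phi i))) v y byy.
  by apply/sat_FAll => i si; apply: ncov; exists i.
move/sat_FAll => nsx; have [i si] := cov x bx; exact: nsx si.
Qed.

Lemma elem_near (a : M) (y : N) : exists n, ball n (f a) y.
Proof. exact: ef.1. Qed.

End Elementary.

Lemma elementary_id {L : language} (M : lstruct L) :
  local_structure M -> elementary (@id M).
Proof. by move=> lM; split. Qed.

(** * Local ultraproducts *)

Section Ultrafilters.
Context {I : Type} {F : set_system I} {UF : UltraFilter F}.

Lemma ultraN (A : set I) : F (~` A) <-> ~ F A.
Proof.
split=> [FnA FA|nFA]; last by case: (in_ultra_setVsetC A UF).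
have FI : F (A `&` ~` A) by exact: filterI.
by apply: (@filter_not_empty _ F ultra_proper); rewrite -(setICr A).
Qed.

Lemma ultra_ex (J : finType) (A : J -> set I) :
  F [set i | exists j, A j i] -> exists j, F (A j).
Proof.
move=> FA; apply: contrapT => nF.
have FnA : F [set i | forall j, ~ A j i].
  apply: (filter_forall (f := fun j => ~` A j)) => j.
  by apply/ultraN => FAj; apply: nF; exists j.
apply: (@filter_not_empty _ F ultra_proper); apply: filterS (filterI FA FnA).
by move=> i [[j Aj]] /(_ j).
Qed.

End Ultrafilters.

Section Ultraproduct.
Context {L : language} (M : lstruct L) (I : Type) (F : set_system I).
Context {UF : UltraFilter F} (N : I -> lstruct L) (f : forall i, M -> N i).
Hypothesis ef : forall i, elementary (f i).
Hypothesis lM : local_structure M.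

(* Only families at bounded distance from the diagonal are kept, which makes the
   ultraproduct local. *)
Definition bdd (x : forall i, N i) : Prop :=
  exists a n, F [set i | ball n (f i a) (x i)].

Definition ucls (x : forall i, N i) : set (forall i, N i) :=
  [set y | F [set i | x i = y i]].

(** Points are the equivalence classes themselves, so that true equality, which [sat] uses, is
    equality almost everywhere. *)
Definition ucarrier : Type :=
  {A : set (forall i, N i) | exists x, bdd x /\ A = ucls x}.

Definition umk (x : forall i, N i) (bx : bdd x) : ucarrier :=
  exist _ (ucls x) (ex_intro _ x (conj bx erefl)).

Definition urep (c : ucarrier) : forall i, N i := projT1 (cid (svalP c)).

Lemma urep_bdd c : bdd (urep c).
Proof. by rewrite /urep; case: cid => x []. Qed.

Lemma urepK c : sval c = ucls (urep c).
Proof. by rewrite /urep; case: cid => x []. Qed.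

Lemma ucls_eq x y : F [set i | x i = y i] -> ucls x = ucls y.
Proof.
move=> Fxy; rewrite eqEsubset; split=> z /= Fz.
  by apply: filterS (filterI Fxy Fz) => i [/= -> ->].
by apply: filterS (filterI Fxy Fz) => i [/= -> ->].
Qed.

Lemma ueqP c d : c = d <-> F [set i | urep c i = urep d i].
Proof.
split=> [->|Fcd]; first exact: filterS filterT.
apply: eq_sig_hprop => [x|]; first exact: Prop_irrelevance.
by rewrite !urepK; apply: ucls_eq.
Qed.

Lemma umkK x (bx : bdd x) : F [set i | urep (umk bx) i = x i].
Proof.
have : ucls (urep (umk bx)) x by rewrite -urepK /=; apply: filterS filterT.
by [].
Qed.

Lemma umk_eq x y (bx : bdd x) (by_ : bdd y) : x = y -> umk bx = umk by_.
Proof.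
by move=> exy; subst y; apply: eq_sig_hprop => // z; apply: Prop_irrelevance.
Qed.

Definition ubase : rstruct (lsig L) :=
  @RStruct (lsig L) ucarrier
    (fun R v => F [set i | interp R (fun k => urep (v k) i)]).

Lemma um1E (x y : ubase) : m1 x y <-> F [set i | m1 (urep x i) (urep y i)].
Proof.
rewrite /m1 /=; split; apply: filterS => i /=.
  by rewrite (pair2_comp (fun c => urep c i)).
by rewrite (pair2_comp (fun c => urep c i)).
Qed.

Lemma diag_bdd a : bdd (fun i => f i a).
Proof. by exists a, 0; apply: filterS filterT. Qed.

Definition udiag (a : M) : ubase := umk (diag_bdd a).

Fact um1_refl (x : ubase) : m1 x x.
Proof. by apply/um1E; apply: filterS filterT => i _; apply: m1_refl. Qed.

Fact um1_sym (x y : ubase) : m1 x y -> m1 y x.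
Proof. by move/um1E => xy; apply/um1E; apply: filterS xy => i; apply: m1_sym. Qed.

Fact u_inhabited : inhabited ubase.
Proof. by have [a] := lstruct_inhabited M; exists; apply: udiag. Qed.

Definition ultraproduct : lstruct L := LStruct um1_refl um1_sym u_inhabited.

Theorem los n (phi : formula L n) (v : 'I_n -> ultraproduct) :
  sat phi v <-> F [set i | sat phi (fun k => urep (v k) i)].
Proof.
elim: phi v => {n} [n|n j k|n R s|n phi IH|n phi IH psi IH'|n j phi IH] v /=.
- by split=> // F0; apply: (@filter_not_empty _ F _).
- exact: ueqP.
- by [].
- by rewrite IH -ultraN.
- rewrite IH IH'; split=> [[Fp Fq]|Fpq]; first exact: filterI.
  by split; apply: filterS Fpq => i [].
- split=> [[z [/um1E zj /IH sz]]|Fex].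
    apply: filterS (filterI zj sz) => i [/= mz si]; exists (urep z i).
    by move: si; rewrite (scons_comp (fun c => urep c i)).
  (* Witnesses are chosen index by index, with [v j] as default where there is none. *)
  have zX i : {z : N i |
      (exists z, m1 z (urep (v j) i) /\ sat phi (scons z (fun k => urep (v k) i))) ->
      m1 z (urep (v j) i) /\ sat phi (scons z (fun k => urep (v k) i))}.
    apply: cid; have [[z sz]|nz] := pselect (exists z, m1 z (urep (v j) i) /\
      sat phi (scons z (fun k => urep (v k) i))); first by exists z.
    by exists (urep (v j) i).
  pose z i := sval (zX i); have zP i := svalP (zX i); rewrite -/(z _) in zP.
  (* Locality of the quantifier enters here: a witness stays next to [v j], so the chosen family is
     bounded and defines a point. *)
  have bz : bdd z.
    have [a [l Fl]] := urep_bdd (v j); exists a, (l + 1).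
    apply: filterS (filterI Fex Fl) => i [/zP [/= mz _] bj].
    by apply: ball_trans bj _; apply/ball1/m1_sym.
  exists (umk bz); split.
    by apply/um1E; apply: filterS (filterI Fex (umkK bz)) => i [/zP[? _]] /= ->.
  apply/IH; apply: filterS (filterI Fex (umkK bz)) => i [/zP[_ sz]] /= e.
  by rewrite (scons_comp (fun c => urep c i)) e.
Qed.

Lemma los_umk n (phi : formula L n) (x : 'I_n -> forall i, N i)
    (bx : forall k, bdd (x k)) :
  sat (M := ultraproduct) phi (fun k => umk (bx k)) <->
  F [set i | sat phi (fun k => x k i)].
Proof.
rewrite los; have Fx : F [set i | forall k, urep (umk (bx k)) i = x k i].
  by apply: filter_forall => k; apply: umkK.
split=> Fs; apply: filterS (filterI Fs Fx) => i [/= si xi].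
  by move: si; congr (sat phi _); apply/funext => k; apply: xi.
by move: si; congr (sat phi _); apply/funext => k; rewrite xi.
Qed.

Lemma ultraproduct_local : local_structure ultraproduct.
Proof.
move=> x y; have [a [l Fa]] := urep_bdd x; have [b [m Fb]] := urep_bdd y.
have [n ab] := lM a b; exists (l + (n + m)).
have := los (FBall (l + (n + m)) ord0 (lift ord0 ord0)) (pair2 x y).
rewrite sat_FBall => ->; apply: filterS (filterI Fa Fb) => i [/= xa yb].
apply/sat_FBall; rewrite pair2l pair2r; apply: ball_trans (ball_sym xa) _.
by apply: ball_trans yb; apply/(elem_ball (ef i)).
Qed.

Lemma udiag_elementary : @elementary _ M ultraproduct udiag.
Proof.
split=> [|n phi v]; first exact: ultraproduct_local.
rewrite -[sat (M := ultraproduct) _ _]/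
  (sat (M := ultraproduct) phi (fun k => umk (diag_bdd (v k)))) los_umk.
split=> [sv|Fs]; first by apply: filterS filterT => i _; apply/(elem_sat (ef i)).
by have [i /(elem_sat (ef i))] := filter_ex Fs.
Qed.

Lemma los_type (x : forall i, N i) (bx : bdd x) n (phi : formula L n.+1)
    (a : 'I_n -> M) :
  sat (M := ultraproduct) phi (scons (umk bx) (fun k => udiag (a k))) <->
  F [set i | sat phi (scons (x i) (fun k => f i (a k)))].
Proof.
have bv k : bdd (scons x (fun j i => f i (a j)) k).
  by move: k; apply: ord_ind => [|k]; rewrite ?scons0 ?sconsS //; apply: diag_bdd.
have := los_umk phi bv.
rewrite (_ : (fun k => umk (bv k)) = scons (umk bx) (fun k => udiag (a k))).
  move=> ->; rewrite (_ : (fun i => _) = (fun i =>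
    sat phi (scons (x i) (fun k => f i (a k))))) //.
  by apply/funext => i; rewrite (scons_comp (fun y : forall i, N i => y i)).
apply/funext => k; rewrite /udiag; case: (unliftP ord0 k) => [j ->|->].
  by rewrite [RHS]sconsS; apply: umk_eq; rewrite sconsS.
by rewrite [RHS]scons0; apply: umk_eq; rewrite scons0.
Qed.

End Ultraproduct.

(** * Type spaces *)

Section Types.
Context {L : language} {M : lstruct L}.
Implicit Types p q : ltype M.

Lemma ltype_eq p q :
  (forall n (phi : formula L n.+1) a, type_of p phi a <-> type_of q phi a) -> p = q.
Proof.
case: p q => [p tp] [q tq] /= pq.
have epq : p = q.
  apply/functional_extensionality_dep => n.
  apply/funext => phi; apply/funext => a; exact/propext.
by subst q; rewrite (Prop_irrelevance tp tq).
Qed.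

Lemma type_not p n (phi : formula L n.+1) a :
  type_of p (FNot phi) a <-> ~ type_of p phi a.
Proof. by have [N [f [ef [c cp]]]] := ltypeP p; rewrite !cp. Qed.

Lemma type_merge p m n (phi : formula L m.+1) (psi : formula L n.+1) a b :
  type_of p (FMerge phi psi) (vcat a b) <-> type_of p phi a /\ type_of p psi b.
Proof.
by have [N [f [ef [c cp]]]] := ltypeP p; rewrite !cp vcat_comp sat_FMerge.
Qed.

(** The realization lies at finite distance from a point [a0] of [M]. With [a0] as an extra
    parameter the existence of a solution becomes a bounded existential, which descends to [M]. *)
Lemma type_sat p n (phi : formula L n.+1) a :
  type_of p phi a -> exists x, sat phi (scons x a).
Proof.
have [N [f [ef [c cp]]]] := ltypeP p; rewrite cp => sc.
have [a0] := lstruct_inhabited M; have [l bl] := elem_near ef a0 c.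
pose v := scons a0 a.
pose psi := FSubst phi (scons (@ord0 n.+1) (fun i => lift ord0 (lift ord0 i))).
have psiE (N' : lstruct L) (y : N') (w : 'I_n.+1 -> N') :
    sat psi (scons y w) <-> sat phi (scons y (fun i => w (lift ord0 i))).
  rewrite sat_FSubst scons_comp scons0.
  by rewrite (_ : (fun i => _) = fun i => w (lift ord0 i)) //;
    apply/funext => i; rewrite sconsS.
have [||x [_]] := elem_exb ef (l := l) (i := ord0) (phi := psi) (v := v) (y := c).
- by rewrite /v scons0.
- apply/psiE; rewrite (_ : (fun i => _) = fun i => f (a i)) //.
  by apply/funext => i; rewrite /v sconsS.
move/psiE; rewrite (_ : (fun i => _) = a); first by exists x.
by apply/funext => i; rewrite /v sconsS.
Qed.

(** Otherwise [phi] and the negation of [psi] would both lie in [p], and [type_sat] would give a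
    common solution in [M]. *)
Lemma type_imp p m n (phi : formula L m.+1) (psi : formula L n.+1) a b :
  (forall x, sat phi (scons x a) -> sat psi (scons x b)) ->
  type_of p phi a -> type_of p psi b.
Proof.
move=> imp pphi; apply: contrapT => /type_not npsi.
have /type_sat[x] := (type_merge p phi (FNot psi) a b).2 (conj pphi npsi).
by move/sat_FMerge => -[/imp].
Qed.

Definition inball p l (y : M) : Prop :=
  type_of p (FBall l ord0 (lift ord0 ord0)) (fun _ : 'I_1 => y).

Lemma sat_inball (N : lstruct L) l (x y : N) :
  sat (FBall l ord0 (lift ord0 ord0)) (scons x (fun _ : 'I_1 => y)) <-> ball l x y.
Proof. by rewrite sat_FBall scons0 sconsS. Qed.

Lemma inball_shift p l m x y : ball m x y -> inball p l x -> inball p (l + m) y.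
Proof.
move=> xy; apply: type_imp => z /sat_inball zx; apply/sat_inball.
exact: ball_trans zx xy.
Qed.

Lemma inball_le p l m y : (l <= m)%N -> inball p l y -> inball p m y.
Proof.
by move=> lm; apply: type_imp => z /sat_inball zx; apply/sat_inball/(ball_le lm).
Qed.

Lemma inball_near p y : exists l, inball p l y.
Proof.
have [N [f [ef [c cp]]]] := ltypeP p; have [l bl] := elem_near ef y c.
by exists l; apply/cp/sat_inball/ball_sym.
Qed.

Lemma inball_dist p l m x y : inball p l x -> inball p m y -> ball (l + m) x y.
Proof.
have [N [f [ef [c cp]]]] := ltypeP p => /cp/sat_inball cx /cp/sat_inball cy.
by apply/(elem_ball ef); apply: ball_trans (ball_sym cx) cy.
Qed.

Fact is_type_tp (lM : local_structure M) (x : M) :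
  is_type (fun n (phi : formula L n.+1) a => sat phi (scons x a)).
Proof. by exists M, id; split; [exact: elementary_id | exists x]. Qed.

Definition tp (lM : local_structure M) (x : M) : ltype M := LType (is_type_tp lM x).

(** Realizations of the [p i] form a family bounded around [y]; its class in the local ultraproduct
    realizes the limit type. *)
Lemma type_limit (lM : local_structure M) (I : Type) (F : set_system I)
    (UF : UltraFilter F) (p : I -> ltype M) l y :
  F [set i | inball (p i) l y] ->
  exists q, forall n (phi : formula L n.+1) a,
    type_of q phi a <-> F [set i | type_of (p i) phi a].
Proof.
move=> Fy.
have rz i : {N : lstruct L & {f : M -> N & {c : N |
    elementary f /\ realizes f c (type_of (p i))}}}.
  have /cid[N /cid[f /cid[c cP]]] : exists N : lstruct L, exists f : M -> N, exists c,
      elementary f /\ realizes f c (type_of (p i)).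
    have [N [f [ef [c cp]]]] := ltypeP (p i).
    by exists N, f, c.
  by exists N, f, c.
pose N i := projT1 (rz i); pose f i : M -> N i := projT1 (projT2 (rz i)).
pose c i : N i := sval (projT2 (projT2 (rz i))).
have ef i : elementary (f i) := (svalP (projT2 (projT2 (rz i)))).1.
have cp i : realizes (f i) (c i) (type_of (p i)) :=
  (svalP (projT2 (projT2 (rz i)))).2.
have bc : bdd F f c.
  exists y, l; apply: filterS Fy => i.
  by rewrite /= /inball cp => /sat_inball/ball_sym.
have tq : is_type (fun n (phi : formula L n.+1) a => F [set i | type_of (p i) phi a]).
  exists (@ultraproduct _ M I F UF N f), (@udiag _ M I F UF N f); split; first exact: udiag_elementary.
  exists (umk bc) => n phi a; rewrite los_type.
  by split; apply: filterS => i /cp.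
by exists (LType tq).
Qed.

End Types.

(** * Every type is at distance at most 1 from a point of the model *)

Section Doubling.
Context {L : language} (T : theory L) (T_DP : doubling T).
Context {M : lstruct L} (M_model : model T M).

(** Doubling is iterated from radius [n] down to radius 1, where it stops because (DP) starts at
    scale 1. *)
Lemma ball_cover n (a : M) :
  exists (m : nat) (c : 'I_m -> M), forall x, ball n a x -> exists i, ball 1 (c i) x.
Proof.
have one b : exists (m : nat) (c : 'I_m -> M),
    forall x, ball 1 b x -> exists i, ball 1 (c i) x.
  by exists 1, (fun _ => b) => x bx; exists ord0.
case: n => [|n]; first by have [m [c cP]] := one a; exists m, c => x ax;
  apply: cP; apply: ball_le ax.
elim: n a => [//|n IH] a.
have [m DP] := T_DP (ltn0Sn n); have [c cP] := DP M M_model a.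
(* Centres are sequences over [nat] with a bound on the index, so that the type of the choice does
   not depend on the number of centres. *)
have /choice[mm /choice[cc ccP]] : forall i, exists mi, exists ci : nat -> M,
    forall x, ball n.+1 (c i) x -> exists j, (j < mi)%N /\ ball 1 (ci j) x.
  move=> i; have [mi [ci ciP]] := IH (c i); exists mi.
  exists (fun j => if insub j is Some j' then ci j' else a) => x /ciP[j bj].
  by exists j; split=> //; rewrite valK.
pose J : finType := {i : 'I_m & 'I_(mm i)}.
exists #|J|, (fun k => let t : J := enum_val k in cc (tag t) (tagged t)).
move=> x /cP[i] /ccP[j [jm bj]].
pose t : J := Tagged _ (Ordinal jm).
by exists (enum_rank t) => /=; rewrite enum_rankK.
Qed.

(** A realization lies in some ball around a point of [M]; that ball has a finite cover by unit
    balls centred in [M], and [elem_cover] extends the cover to the realization. *)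
Lemma inball1 (p : ltype M) : exists y, inball p 1 y.
Proof.
have [a] := lstruct_inhabited M.
have [N [f [ef [x xp]]]] := ltypeP p; have [l bl] := elem_near ef a x.
have [m [c cP]] := ball_cover l a.
pose v := vcat c (fun _ : 'I_1 => a).
have [i] : exists i : 'I_m,
    sat (FBall 1 ord0 (lift ord0 (lshift 1 i))) (scons x (fun k => f (v k))).
  apply: (elem_cover ef (l := l) (j := rshift m ord0) (v := v)
    (phi := fun i : 'I_m => FBall 1 ord0 (lift ord0 (lshift 1 i)))).
    move=> y; rewrite /v vcatr => /cP[i bi]; exists i; apply/sat_FBall.
    by rewrite scons0 sconsS vcatl; apply: ball_sym.
  by rewrite /v vcatr.
rewrite sat_FBall scons0 sconsS /v vcatl => bx; exists (c i).
exact/xp/sat_inball.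
Qed.

End Doubling.

Lemma ord2_cases (i : 'I_2) : i = ord0 \/ i = lift ord0 ord0.
Proof.
by move: i; apply: ord_ind => [|i]; [left|right; rewrite (ord1 i)].
Qed.

(** * Distance between types through atomic relations *)

Section Distance.
Context {L : language}.

(* In type spaces: points of M close to p and to q are at distance at most l;
   for l = 5 this is [mu_pattern]. *)
Definition near_pattern l : pattern L :=
  @Pattern L 2 2 (fun i => FNot (FM1 ord0 (lift ord0 i)))
    (FNot (FBall l ord0 (lift ord0 ord0))).

(** Holds when no point of [M] is within [l] of both types. Its failure is thus an open form of
    closeness, beside the closed form given by [near_pattern]. *)
Definition far_pattern l : pattern L :=
  @Pattern L 2 1 (fun i => FNot (FBall l ord0 (lift ord0 ord0))) (FTrue 1).

Definition neard (A : rstruct (psig L)) l (x y : A) : Prop :=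
  interp (near_pattern l : sym (psig L)) (pair2 x y).

Definition fard (A : rstruct (psig L)) l (x y : A) : Prop :=
  interp (far_pattern l : sym (psig L)) (pair2 x y).

Section Morphisms.
Context {A B : rstruct (psig L)} {f : A -> B}.

Lemma neard_hom (hf : homomorphism f) l x y : neard l x y -> neard l (f x) (f y).
Proof. by move/hf; rewrite pair2_comp. Qed.

Lemma fard_hom (hf : homomorphism f) l x y : fard l x y -> fard l (f x) (f y).
Proof. by move/hf; rewrite pair2_comp. Qed.

Lemma neard_emb (ef : embedding f) l x y : neard l x y <-> neard l (f x) (f y).
Proof. by rewrite /neard ef.2 pair2_comp. Qed.

Lemma fard_emb (ef : embedding f) l x y : fard l x y <-> fard l (f x) (f y).
Proof. by rewrite /fard ef.2 pair2_comp. Qed.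

End Morphisms.

Lemma emb_hom (A B : rstruct (psig L)) (f : A -> B) : embedding f -> homomorphism f.
Proof. by move=> ef R v; rewrite (ef.2 R v). Qed.

Lemma aut_emb (A : rstruct (psig L)) (g : aut A) : embedding g.
Proof. by split; [exact: can_inj (aut_funK g)|exact: aut_interp]. Qed.

Section TypeSpace.
Context {M : lstruct L}.
Implicit Types p q r : type_space M.

Lemma type_m1E (p : ltype M) n (i : 'I_n) (a : 'I_n -> M) :
  type_of p (FM1 ord0 (lift ord0 i)) a <-> inball p 1 (a i).
Proof.
by split; apply: type_imp => x; rewrite sat_FM1 sat_inball ball1 scons0 sconsS.
Qed.

Lemma type_ballE (p : ltype M) l n (i : 'I_n) (a : 'I_n -> M) :
  type_of p (FBall l ord0 (lift ord0 i)) a <-> inball p l (a i).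
Proof.
by split; apply: type_imp => x; rewrite sat_inball sat_FBall scons0 sconsS.
Qed.

Lemma neardP l p q :
  neard l p q <-> forall y z, inball p 1 y -> inball q 1 z -> ball l y z.
Proof.
split=> [npq y z py qz|H a na].
  apply: contrapT => nyz; have [|i] := npq (pair2 y z).
    by move/sat_FBall.
  move/type_not; rewrite type_m1E.
  by case: (ord2_cases i) => ->; rewrite !(pair2l, pair2r).
apply: contrapT => nex; apply: na; apply/sat_FBall; apply: H.
  apply: contrapT => np; apply: nex; exists ord0; apply/type_not.
  by rewrite type_m1E pair2l.
apply: contrapT => nq; apply: nex; exists (lift ord0 ord0); apply/type_not.
by rewrite type_m1E pair2r.
Qed.

Lemma fardP l p q : fard l p q <-> ~ exists y, inball p l y /\ inball q l y.
Proof.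
split=> [fpq [y [py qy]]|H a _].
  have [|i] := fpq (fun _ => y); first by [].
  move/type_not; rewrite type_ballE.
  by case: (ord2_cases i) => ->; rewrite !(pair2l, pair2r).
have [pa|pa] := pselect (inball p l (a ord0)).
  exists (lift ord0 ord0); apply/type_not; rewrite type_ballE pair2r => qa.
  by apply: H; exists (a ord0).
by exists ord0; apply/type_not; rewrite type_ballE pair2l.
Qed.

Lemma type_act_hom (g : aut M) : homomorphism (type_act g : type_space M -> type_space M).
Proof.
move=> t v tv a; rewrite (sat_aut (aut_sym g)) => /tv[i pi]; exists i; exact: pi.
Qed.

Lemma inball_act (g : aut M) p l y : inball (type_act g p) l (g y) <-> inball p l y.
Proof.
rewrite /inball /= /pretype_act; rewrite (_ : (fun _ => _) = fun=> y) //.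
by apply/funext => i; rewrite aut_funK.
Qed.

Hypothesis near1 : forall p, exists y, inball p 1 y.

(** Two points of [M] within 1 of the same type are within 2 of each other; replacing both [y] and
    [z] costs 4. *)
Lemma neard_ball l p q y z :
  inball p 1 y -> inball q 1 z -> ball l y z -> neard (l + 4) p q.
Proof.
move=> py qz yz; apply/neardP => y' z' py' qz'.
have -> : (l + 4 = 2 + (l + 2))%N by rewrite addnCA.
apply: ball_trans (inball_dist py' py) _.
exact: ball_trans yz (inball_dist qz qz').
Qed.

Lemma neard_sym l p q : neard l p q -> neard l q p.
Proof.
move=> /neardP npq; apply/neardP => y z py qz.
exact/ball_sym/npq.
Qed.

(** [near1] supplies the intermediate point; if no point of [M] were next to [q], both assumptions
    would be vacuous. *)
Lemma neard_trans l m p q r : neard l p q -> neard m q r -> neard (l + m) p r.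
Proof.
move=> /neardP pq /neardP qr; apply/neardP => y z py rz.
have [w qw] := near1 q; exact: ball_trans (pq _ _ py qw) (qr _ _ qw rz).
Qed.

(** Together with [neard_nfard]: the open and the closed form of closeness imply each other up to a
    change of radius. *)
Lemma nfard_neard l p q : ~ fard l p q -> neard ((l + l).+2) p q.
Proof.
move=> nf; have [y [py qy]] : exists y, inball p l y /\ inball q l y.
  by apply: contrapT => ne; apply: nf; apply/fardP.
apply/neardP => x z px qz.
have -> : ((l + l).+2 = (1 + l) + (l + 1))%N by rewrite add1n addn1 addnS addSn.
exact: ball_trans (inball_dist px py) (inball_dist qy qz).
Qed.

Lemma neard_nfard l p q : neard l p q -> ~ fard l.+1 p q.
Proof.
move=> /neardP pq; have [y py] := near1 p; have [z qz] := near1 q.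
move/fardP; apply; exists z; split.
  by rewrite -add1n; apply: inball_shift (pq _ _ py qz) py.
exact: inball_le qz.
Qed.

Lemma fard_le l m p q : (l <= m)%N -> fard m p q -> fard l p q.
Proof.
move=> lm /fardP nf; apply/fardP => -[y [py qy]]; apply: nf; exists y.
by split; apply: inball_le lm _.
Qed.

Lemma fard_refl p : ~ fard 1 p p.
Proof. by move/fardP; apply; have [y py] := near1 p; exists y. Qed.

Lemma neard_ex p q : local_structure M -> exists l, neard l p q.
Proof.
move=> lM; have [y py] := near1 p; have [z qz] := near1 q.
by have [l yz] := lM y z; exists (l + 4); apply: neard_ball yz.
Qed.

(* If p and h p had no common neighbour then neither would h p and h (h p) = h p. *)
Lemma retract_nfard (h : type_space M -> type_space M) p :
  homomorphism h -> h (h p) = h p -> ~ fard 1 p (h p).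
Proof.
by move=> hh hhp /(fard_hom hh); rewrite hhp; apply: fard_refl.
Qed.

End TypeSpace.
End Distance.

Lemma vcat_eta (X : Type) m n (w : 'I_(m + n) -> X) :
  vcat (fun i => w (lshift n i)) (fun i => w (rshift m i)) = w.
Proof.
apply/funext => i; rewrite -(splitK i).
by case: (fintype.split i) => j; rewrite ?vcatl ?vcatr.
Qed.

(** * Lascar-Shelah neighbours *)

Section Partitions.
Context {L : language} (k : nat).
Implicit Types M N : lstruct L.

(** Bundled with its number of variables, so that lists of families can be formed in compactness
    arguments. *)
Record family := Family {
  fam_size : nat;
  fam_dom : formula L fam_size.+1;
  fam_rel : formula L fam_size.+3 }.

Definition flp M (e : family) : Prop :=
  finite_local_partitions k M (fam_dom e) (fam_rel e).

Definition same_class M (e : family) (x y : M) : Prop :=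
  exists z : 'I_(fam_size e).+1 -> M, sat (fam_rel e) (scons x (scons y z)).

(** Needed in [sh_fin_type], where neighbours in an ultrapower are tested against families of the
    ultrapower. *)
Lemma flp_elem M N (F : M -> N) (eF : elementary F) e : flp N e -> flp M e.
Proof.
case: e => n B E [/= [z0 Bz0] [f [kf E_ball B_ball E_equiv]]].
have onB (z : 'I_n.+1 -> M) : sat B (fun i => F (z i)) <-> sat B z by apply: elem_sat.
have rE (z : 'I_n.+1 -> M) x y : sat E (scons (F x) (scons (F y) (fun i => F (z i)))) <->
    sat E (scons x (scons y z)).
  by rewrite -(elem_sat eF) !scons_comp.
split.
  (* The tuple [z0] lies within [l + f] of the image of [a], so the existence of such a tuple is a
     local formula about [a]. *)
  have [a] := lstruct_inhabited M; have [l bl] := elem_near eF a (z0 ord0).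
  have := elem_sat eF (FExT (l + f) (@ord0 0) (FSubst B (lshift 1))) (fun=> a).
  rewrite !sat_FExT => -[+ _]; case.
    exists z0; split=> [i|]; first exact: ball_trans bl (B_ball _ Bz0 i).
    by apply/sat_FSubst; rewrite (_ : (fun i => _) = z0) //; apply/funext => i; rewrite vcatl.
  move=> z [_ /sat_FSubst]; rewrite (_ : (fun i => _) = z); first by exists z.
  by apply/funext => i; rewrite vcatl.
exists f; split=> //.
- move=> z x y /rE/E_ball[/onB Bz xz yz].
  by split=> //; apply/(elem_ball eF).
- by move=> z /onB Bz i; apply/(elem_ball eF)/(B_ball _ Bz).
- move=> z Bz; have /E_equiv[Er Es Et [c cP]] := (onB z).2 Bz; split.
  + by move=> x /(elem_ball eF)/Er/rE.
  + by move=> x y /rE/Es/rE.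
  + by move=> x y w /rE xy /rE yw; apply/rE; apply: Et xy yw.
  (* Representatives [c i] may lie outside the image of [M]: each is replaced by a point of [M] in
     its class if there is one, and by an arbitrary point otherwise. *)
  + have /choice[c' c'P] : forall i, exists x : M,
        (exists y, sat E (scons (F y) (scons (c i) (fun i => F (z i))))) ->
        sat E (scons (F x) (scons (c i) (fun i => F (z i)))).
      move=> i; have [[y Ey]|nE] := pselect (exists y : M,
        sat E (scons (F y) (scons (c i) (fun i => F (z i))))); first by exists y.
      by have [a] := lstruct_inhabited M; exists a => y; case: nE.
    exists c' => x /(elem_ball eF)/cP[i Ei]; exists i; apply/rE.
    exact: Et _ _ _ Ei (Es _ _ (c'P i (ex_intro _ x Ei))).
Qed.

Section Model.
Context {M : lstruct L}.
Hypothesis lM : local_structure M.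
Hypothesis near1 : forall p : type_space M, exists y, inball p 1 y.
Implicit Types p q : type_space M.

Definition flps (es : seq family) : Prop := forall e, List.In e es -> flp M e.

(** [E] puts [z] number 0 within [f] of [x], and [B] puts the other coordinates within [f] of it.
    The quantifier over [z] is therefore bounded by [f + f] around [x], hence local. *)
Lemma same_class_formula e : flp M e ->
  exists theta : formula L 2, forall v : 'I_2 -> M,
    sat theta v <-> same_class e (v ord0) (v (lift ord0 ord0)).
Proof.
case: e => n B E [/= _ [f [_ E_ball B_ball _]]]; rewrite /same_class /=.
pose s : 'I_n.+3 -> 'I_(n.+1 + 2) :=
  scons (rshift n.+1 ord0) (scons (rshift n.+1 (lift ord0 ord0)) (lshift 2)).
exists (FExT (f + f) ord0 (FSubst E s)) => v.
have sE z : (fun i => vcat z v (s i)) =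
    scons (v ord0) (scons (v (lift ord0 ord0)) z).
  rewrite /s !scons_comp !vcatr; congr (scons _ (scons _ _)).
  by apply/funext => i; rewrite vcatl.
rewrite sat_FExT; split=> [[z [_]]|[z Ez]]; first by rewrite sat_FSubst sE; exists z.
exists z; split; last by rewrite sat_FSubst sE.
by move=> i; have [Bz xz _] := E_ball _ _ _ Ez; apply: ball_trans xz (B_ball _ Bz i).
Qed.

Lemma same_classes_formula es : flps es ->
  exists theta : formula L 2, forall v : 'I_2 -> M,
    sat theta v <->
    forall e, List.In e es -> same_class e (v ord0) (v (lift ord0 ord0)).
Proof.
elim: es => [|e es IH] hes; first by exists (FTrue 2) => v /=; split=> // _ [].
have [|th thP] := IH; first by move=> e' ie'; apply: hes; right.
have [|th0 th0P] := @same_class_formula e; first by apply: hes; left.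
exists (FAnd th0 th) => v /=; rewrite thP th0P; split=> [[h0 h] e' [<-|]|h] //.
  exact: h.
by split=> [|e' ie']; apply: h; [left|right].
Qed.

(* Compactness turns this finitary condition into [sh_type]; unlike [sh_type]
   it is visibly preserved by homomorphisms. *)
Definition sh_fin p q : Prop := forall es, flps es ->
  forall m n (phi : formula L m.+1) (psi : formula L n.+1) a b,
    type_of p phi a -> type_of q psi b ->
    exists x y : M, [/\ sat phi (scons x a), sat psi (scons y b) &
      forall e, List.In e es -> same_class e x y].

(** Let [alpha] say that no solutions of [phi] and [psi] share a class for every family in [es]; the
    bounds on [phi] and [psi] make it local. As [sh_fin p q] holds, the pattern with entries ~
    [phi], ~ [psi] and domain [alpha] holds at [p], [q], hence at [h p], [h q]. If the conclusion
    failed, [a], [b] would satisfy [alpha], a contradiction. *)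
Lemma sh_fin_hom_bounded (h : type_space M -> type_space M) p q es l m n
    (phi : formula L m.+1) (psi : formula L n.+1) (i : 'I_m) (j : 'I_n)
    (a : 'I_m -> M) (b : 'I_n -> M) :
  homomorphism h -> sh_fin p q -> flps es ->
  (forall (x : M) w, sat phi (scons x w) -> ball l (w i) x) ->
  (forall (x : M) w, sat psi (scons x w) -> ball l (w j) x) ->
  type_of (h p) phi a -> type_of (h q) psi b ->
  exists x y : M, [/\ sat phi (scons x a), sat psi (scons y b) &
    forall e, List.In e es -> same_class e x y].
Proof.
move=> hh pq hes bphi bpsi hphi hpsi; apply: contrapT => nxy.
have [theta thetaP] := same_classes_formula hes.
pose iphi : 'I_m.+1 -> 'I_(m + n).+1 := scons ord0 (fun i => lift ord0 (lshift n i)).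
pose ipsi : 'I_n.+1 -> 'I_(m + n).+1 := scons ord0 (fun i => lift ord0 (rshift m i)).
pose chi : formula L (m + n).+2 :=
  FAnd (FSubst phi (scons (lift ord0 ord0) (fun i => lift ord0 (lift ord0 (lshift n i)))))
   (FAnd (FSubst psi (scons ord0 (fun i => lift ord0 (lift ord0 (rshift m i)))))
     (FSubst theta (pair2 (lift ord0 ord0) ord0))).
pose alpha : formula L (m + n) :=
  FNot (FExB l (lshift n i) (FExB l (lift ord0 (rshift m j)) chi)).
have chiP (u : 'I_(m + n) -> M) x y : sat chi (scons y (scons x u)) <->
    [/\ sat phi (scons x (fun i => u (lshift n i))),
        sat psi (scons y (fun i => u (rshift m i))) &
        forall e, List.In e es -> same_class e x y].
  rewrite /chi !sat_FAnd !sat_FSubst !scons_comp pair2_comp scons0 sconsS scons0.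
  have eu k0 : scons y (scons x u) (lift ord0 (lift ord0 k0)) = u k0.
    by rewrite !sconsS.
  have -> : (fun k0 => scons y (scons x u) (lift ord0 (lift ord0 (lshift n k0)))) =
    fun k0 => u (lshift n k0) by apply/funext => k0; rewrite eu.
  have -> : (fun k0 => scons y (scons x u) (lift ord0 (lift ord0 (rshift m k0)))) =
    fun k0 => u (rshift m k0) by apply/funext => k0; rewrite eu.
  by split=> [[? [? /thetaP ?]]|[? ? ?]]; split=> //; split=> //; apply/thetaP.
pose t := @Pattern L 2 (m + n)
  (fun i => if i == ord0 then FNot (FSubst phi iphi) else FNot (FSubst psi ipsi)) alpha.
have iphiE (r : ltype M) u :
    type_of r (FSubst phi iphi) u <-> type_of r phi (fun i => u (lshift n i)).
  have e x : (fun i => scons x u (iphi i)) = scons x (fun i => u (lshift n i)).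
    by rewrite scons_comp scons0; congr scons; apply/funext => c; rewrite sconsS.
  by split; apply: type_imp => x; rewrite sat_FSubst e.
have ipsiE (r : ltype M) u :
    type_of r (FSubst psi ipsi) u <-> type_of r psi (fun i => u (rshift m i)).
  have e x : (fun i => scons x u (ipsi i)) = scons x (fun i => u (rshift m i)).
    by rewrite scons_comp scons0; congr scons; apply/funext => c; rewrite sconsS.
  by split; apply: type_imp => x; rewrite sat_FSubst e.
have pqt : interp (t : sym (psig L)) (pair2 p q : 'I_(pat_size t) -> type_space M).
  move=> u; rewrite /t /= => alu; apply: contrapT => nex; apply: alu.
  have pphi : type_of p phi (fun i => u (lshift n i)).
    apply/iphiE; apply: contrapT => np; apply: nex; exists ord0.
    by rewrite eqxx pair2l; apply/type_not.
  have qpsi : type_of q psi (fun i => u (rshift m i)).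
    apply/ipsiE; apply: contrapT => np; apply: nex; exists (lift ord0 ord0).
    by rewrite pair2r; apply/type_not.
  have [x [y [sx sy exy]]] := pq es hes _ _ _ _ _ _ pphi qpsi.
  apply/sat_FExB; exists x; split; first exact: (bphi x _ sx).
  apply/sat_FExB; exists y; split; last exact/chiP.
  by rewrite sconsS; exact: (bpsi y _ sy).
have : sat alpha (vcat a b).
  move=> /sat_FExB[x [_ /sat_FExB[y [_ /chiP[]]]]].
  rewrite (_ : (fun i => _) = a); last by apply/funext => ?; rewrite vcatl.
  rewrite (_ : (fun i => _) = b); last by apply/funext => ?; rewrite vcatr.
  by move=> sx sy exy; apply: nxy; exists x, y.
move/(hh t _ pqt) => [c]; rewrite /t /=.
have vl : (fun i => vcat a b (lshift n i)) = a by apply/funext => ?; rewrite vcatl.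
have vr : (fun i => vcat a b (rshift m i)) = b by apply/funext => ?; rewrite vcatr.
case: (ord2_cases c) => ->.
  rewrite eqxx pair2l => /type_not; apply; apply/iphiE; by rewrite vl.
by move=> /type_not; apply; apply/ipsiE; rewrite vr.
Qed.

(** Adding to [phi] and [psi] the condition of lying within [l] of a base point [o] reduces to the
    bounded case. *)
Lemma sh_fin_hom (h : type_space M -> type_space M) p q :
  homomorphism h -> sh_fin p q -> sh_fin (h p) (h q).
Proof.
move=> hh pq es hes m n phi psi a b hphi hpsi.
have [o] := lstruct_inhabited M.
have [l1 pl1] := inball_near (h p) o; have [l2 ql2] := inball_near (h q) o.
pose l := maxn l1 l2.
have pl : inball (h p) l o by apply: inball_le pl1; apply: leq_maxl.
have ql : inball (h q) l o by apply: inball_le ql2; apply: leq_maxr.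
pose near_o : formula L 2 := FBall l ord0 (lift ord0 ord0).
have bd r (chi : formula L r.+1) (x : M) w :
    sat (FMerge chi near_o) (scons x w) -> ball l (w (rshift r ord0)) x.
  rewrite -{1}(vcat_eta w) => /sat_FMerge[_ /sat_FBall].
  by rewrite scons0 sconsS => /ball_sym.
have [||x [y [/sat_FMerge[sx _] /sat_FMerge[sy _] exy]]] :=
  sh_fin_hom_bounded hh pq hes (@bd _ phi) (@bd _ psi)
    (a := vcat a (fun=> o)) (b := vcat b (fun=> o)).
- exact/type_merge.
- exact/type_merge.
by exists x, y.
Qed.

(** * A type and its image under an idempotent endomorphism *)

Section Retraction.
Hypothesis M_bounded : orbit_bounded k M.
Variable h : type_space M -> type_space M.
Hypothesis hh : homomorphism h.
Hypothesis h_idem : forall p, h (h p) = h p.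

(* Otherwise the pattern (~ E, ~ E) holds at (p, h p), hence at (h p, h p); but
   some b in B is so close to h p that h p lies in one of the classes of E_b. *)
Lemma retract_class e p : flp M e ->
  exists b, type_of p (fam_rel e) b /\ type_of (h p) (fam_rel e) b.
Proof.
case: e => n B E [/= [z0 Bz0] [f [kf E_ball B_ball E_equiv]]].
apply: contrapT => nb.
pose t := @Pattern L 2 n.+2 (fun _ => FNot E) (FTrue n.+2).
have pht : interp (t : sym (psig L)) (pair2 p (h p) : 'I_(pat_size t) -> type_space M).
  move=> b _; have [pb|npb] := pselect (type_of p E b); last first.
    by exists ord0; apply/type_not.
  by exists (lift ord0 ord0); apply/type_not => hpb; apply: nb; exists b.
have nE b : ~ type_of (h p) E b.
  have := hh pht; rewrite pair2_comp h_idem => /(_ b) /= [//|i].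
  by case: (ord2_cases i) => ->; rewrite ?pair2l ?pair2r => /type_not.
(* An automorphism brings [z0] within [k] of a point next to [h p]. Since [k < f] gives
   [1 + k <= f], the type [h p] lies in the ball that is partitioned. *)
have [y hpy] := near1 (h p); have [g yg] := M_bounded y (z0 ord0).
pose z i := g (z0 i).
have Bz : sat B z by exact: (sat_aut g B z0).1 Bz0.
have hpz : inball (h p) f (z ord0).
  by apply: inball_le kf _; rewrite -add1n; apply: inball_shift yg hpy.
have [_ _ _ [c cP]] := E_equiv z Bz.
have [N [F [eF [d dhp]]]] := ltypeP (h p).
pose v := vcat c z.
pose s i : 'I_n.+3 -> 'I_(f + n.+1).+1 :=
  scons ord0 (scons (lift ord0 (lshift n.+1 i)) (fun j => lift ord0 (rshift f j))).
have sE (N' : lstruct L) i x (w : 'I_(f + n.+1) -> N') :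
    sat (FSubst E (s i)) (scons x w) <->
    sat E (scons x (scons (w (lshift n.+1 i)) (fun j => w (rshift f j)))).
  rewrite sat_FSubst !scons_comp scons0 sconsS.
  by rewrite (_ : (fun j => _) = fun j => w (rshift f j)) //;
    apply/funext => j; rewrite sconsS.
have [i] : exists i, sat (FSubst E (s i)) (scons d (fun j => F (v j))).
  apply: (elem_cover eF (l := f) (j := rshift f ord0)) => [x|].
    rewrite /v vcatr => /cP[i Ei]; exists i; apply/sE; rewrite vcatl.
    by rewrite (_ : (fun j => _) = z) //; apply/funext => j; rewrite vcatr.
  by rewrite /v vcatr; move/dhp: hpz => /sat_inball/ball_sym.
move/sE; rewrite /v vcatl => Ei; apply: (nE (scons (c i) z)); apply/dhp.
move: Ei; rewrite scons_comp; congr (sat E (scons _ (scons _ _))).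
by apply/funext => j; rewrite vcatr.
Qed.

(** The formula [theta] selects one class for each family; two solutions are equivalent because both
    are equivalent to the parameter [c ord0] of that class. *)
Lemma retract_classes es p : flps es ->
  exists m (theta : formula L m.+1) b,
    [/\ type_of p theta b, type_of (h p) theta b &
      forall x y, sat theta (scons x b) -> sat theta (scons y b) ->
        forall e, List.In e es -> same_class e x y].
Proof.
elim: es => [|e es IH] hes.
  have [o] := lstruct_inhabited M; exists 0, (FTrue 1), (fun _ => o).
  have tT q : type_of q (FTrue 1) (fun=> o) by apply/type_not => /type_sat[].
  by split.
have [|m [th [b [pth hpth thP]]]] := IH; first by move=> e' ie'; apply: hes; right.
have fe : flp M e by apply: hes; left.
have [c [pc hpc]] := retract_class p fe.
exists (_ + m), (FMerge (fam_rel e) th), (vcat c b); split; try exact/type_merge.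
move=> x y /sat_FMerge[xc xb] /sat_FMerge[yc yb] e' [<-|]; last exact: thP.
clear hes pc hpc; case: e fe c xc yc => n B E [/= _ [f [_ E_ball _ E_equiv]]] c xc yc.
exists (fun i => c (lift ord0 i)); rewrite -[c]scons_eta in xc yc.
have [Bz _ _] := E_ball _ _ _ xc; have [_ Es Et _] := E_equiv _ Bz.
exact: Et xc (Es _ _ yc).
Qed.

Lemma retract_sh_fin p : sh_fin p (h p).
Proof.
move=> es /(@retract_classes _ p)[r [th [c [pth hpth thP]]]] m n phi psi a b pphi hppsi.
have /type_sat[x /sat_FMerge[xa xc]] := (type_merge p phi th a c).2 (conj pphi pth).
have /type_sat[y /sat_FMerge[yb yc]] :=
  (type_merge (h p) psi th b c).2 (conj hppsi hpth).
by exists x, y; split=> //; apply: thP.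
Qed.

End Retraction.

(** * From finite satisfiability to neighbouring realizations *)

Definition condition : Type := {m : nat & (formula L m.+1 * ('I_m -> M))%type}.

Definition cond_in (p : ltype M) (c : condition) : Prop :=
  type_of p (projT2 c).1 (projT2 c).2.

Definition cond_sat (x : M) (c : condition) : Prop :=
  sat (projT2 c).1 (scons x (projT2 c).2).

Lemma conditions_merge p (cs : seq {c | cond_in p c}) :
  exists m (phi : formula L m.+1) a, type_of p phi a /\
    forall x, sat phi (scons x a) -> forall c, List.In c cs -> cond_sat x (sval c).
Proof.
elim: cs => [|[c pc] cs [m [phi [a [pphi phiP]]]]].
  have [o] := lstruct_inhabited M; exists 0, (FTrue 1), (fun _ => o).
  by split=> //; apply/type_not => /type_sat[].
case: c pc => n [psi b] /= pc.
exists (n + m), (FMerge psi phi), (vcat b a); split; first exact/type_merge.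
by move=> x /sat_FMerge[xb xa] c [<- //|]; apply: phiP.
Qed.

(** Compactness in a local ultrapower of [M], indexed by finite lists of families and of formulas of
    [p] and of [q]; each index has a pair of points of [M] meeting its requirements. *)
Lemma sh_fin_type p q : sh_fin p q -> sh_type k p q.
Proof.
move=> pq.
pose I := (seq {e | flp M e} * seq {c | cond_in p c} * seq {c | cond_in q c})%type.
have /choice[xy xyP] : forall i : I, exists xy : M * M,
    [/\ forall c, List.In c i.1.2 -> cond_sat xy.1 (sval c),
        forall c, List.In c i.2 -> cond_sat xy.2 (sval c) &
        forall e, List.In e i.1.1 -> same_class (sval e) xy.1 xy.2].
  move=> [[es cs] ds] /=.
  have [m [phi [a [pphi phiP]]]] := conditions_merge cs.
  have [n [psi [b [qpsi psiP]]]] := conditions_merge ds.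
  have [|x [y [xa yb exy]]] := pq (List.map sval es) _ _ _ _ _ _ _ pphi qpsi.
    by move=> e /List.in_map_iff[[e' fe] [<- _]].
  exists (x, y); split; [exact: phiP|exact: psiP|].
  by move=> e ie; apply: exy; apply: List.in_map.
(* The ultrafilter contains the final segments of this order; concatenation bounds two indices, so
   each single requirement holds almost everywhere. *)
pose le (i j : I) := [/\ forall c, List.In c i.1.2 -> List.In c j.1.2,
  forall c, List.In c i.2 -> List.In c j.2 &
  forall e, List.In e i.1.1 -> List.In e j.1.1].
pose G : set_system I := [set A | exists i, forall j, le i j -> A j].
have PG : ProperFilter G.
  apply: Build_ProperFilter_ex => [A [i iA]|]; first by exists i; apply: iA.
  split=> [|A B [i iA] [j jB]|A B AB [i iA]].
  - by exists ([::], [::], [::]).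
  - exists (i.1.1 ++ j.1.1, i.1.2 ++ j.1.2, i.2 ++ j.2) => l [/= l1 l2 l3].
    split; [apply: iA|apply: jB]; split=> c ic;
      by [apply: l1; apply/List.in_or_app; auto|apply: l2; apply/List.in_or_app; auto
         |apply: l3; apply/List.in_or_app; auto].
  - by exists i => j /iA/AB.
have [F [UF GF]] := ultraFilterLemma PG.
pose x i := (xy i).1; pose y i := (xy i).2.
have Fp n (phi : formula L n.+1) a : type_of p phi a ->
    F [set i | sat phi (scons (x i) a)].
  move=> pphi; pose c : {c | cond_in p c} :=
    exist _ (existT _ n (phi, a) : condition) pphi.
  apply: GF; exists ([::], [:: c], [::]) => j [/= cj _ _].
  by have [/(_ c) + _ _] := xyP j; apply; apply: cj; left.
have Fq n (phi : formula L n.+1) a : type_of q phi a ->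
    F [set i | sat phi (scons (y i) a)].
  move=> pphi; pose c : {c | cond_in q c} :=
    exist _ (existT _ n (phi, a) : condition) pphi.
  apply: GF; exists ([::], [::], [:: c]) => j [/= _ cj _].
  by have [_ /(_ c) + _] := xyP j; apply; apply: cj; left.
have Fe e : flp M e -> F [set i | same_class e (x i) (y i)].
  move=> fe; pose c : {e | flp M e} := exist _ e fe.
  apply: GF; exists ([:: c], [::], [::]) => j [/= _ _ cj].
  by have [_ _ /(_ c) +] := xyP j; apply; apply: cj; left.
pose f (i : I) := @id M; have ef i : elementary (f i) := elementary_id lM.
have [o] := lstruct_inhabited M.
have bx : bdd F f x.
  have [l /Fp Fl] := inball_near p o; exists o, l; apply: filterS Fl => i.
  by move/sat_inball/ball_sym.
have by_ : bdd F f y.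
  have [l /Fq Fl] := inball_near q o; exists o, l; apply: filterS Fl => i.
  by move/sat_inball/ball_sym.
pose U := @ultraproduct _ M I F UF (fun=> M) f.
pose d : M -> U := @udiag _ M I F UF (fun=> M) f.
have ed : elementary d by apply: udiag_elementary.
exists U, d; split=> //; exists (umk bx), (umk by_); split.
- move=> n phi a; rewrite los_type; split; first exact: Fp.
  move=> Fs; apply: contrapT => /type_not/Fp Fns.
  exact: (ultraN [set i | sat phi (scons (x i) a)]).1 Fns Fs.
- move=> n phi a; rewrite los_type; split; first exact: Fq.
  move=> Fs; apply: contrapT => /type_not/Fq Fns.
  exact: (ultraN [set i | sat phi (scons (y i) a)]).1 Fns Fs.
move=> n B E flpU.
have fe : flp M (Family B E) by apply: (flp_elem ed).
have [/= _ [l [_ E_ball B_ball _]]] := fe.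
have zX i : {z : 'I_n.+1 -> M |
    same_class (Family B E) (x i) (y i) -> sat E (scons (x i) (scons (y i) z))}.
  apply: cid; have [[z Ez]|nE] := pselect (same_class (Family B E) (x i) (y i)).
    by exists z.
  by exists (fun=> o).
have Fz : F [set i | sat E (scons (x i) (scons (y i) (sval (zX i))))].
  by apply: filterS (Fe _ fe) => i /(svalP (zX i)).
pose z j i := sval (zX i) j.
(* [E] and [B] keep the chosen parameters within [l + l] of [x i], so they too define points of the
   ultrapower. *)
have bz j : bdd F f (z j).
  have [b [m Fb]] := bx; exists b, (m + (l + l)); apply: filterS (filterI Fb Fz).
  move=> i [/= bxi Ei]; have [Bz xz _] := E_ball _ _ _ Ei.
  by apply: ball_trans bxi (ball_trans xz (B_ball _ Bz j)).
exists (fun j => umk (bz j)).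
pose w : 'I_n.+3 -> I -> M := scons x (scons y z).
have bw j : bdd F f (w j).
  rewrite /w; case: (unliftP ord0 j) => [j1 ->|->]; rewrite ?scons0 // sconsS.
  by case: (unliftP ord0 j1) => [j2 ->|->]; rewrite ?scons0 // sconsS.
rewrite (_ : scons _ _ = fun j => umk (bw j)).
  apply/los_umk; apply: filterS Fz => i; congr (sat E _).
  by rewrite /w !(scons_comp (fun v : I -> M => v i)).
apply/funext => j; case: (unliftP ord0 j) => [j1 ->|->]; last first.
  by rewrite scons0; apply: umk_eq; rewrite /w scons0.
rewrite sconsS; case: (unliftP ord0 j1) => [j2 ->|->]; last first.
  by rewrite scons0; apply: umk_eq; rewrite /w sconsS scons0.
by rewrite sconsS; apply: umk_eq; rewrite /w !sconsS.
Qed.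

End Model.
End Partitions.

(** * The core and its automorphism group *)

Section PositivePrimitive.
Context {L : language}.

Lemma ppsat_hom (A B : rstruct (psig L)) (f : A -> B) : homomorphism f ->
  forall n (R : ppformula L n) (v : 'I_n -> A),
  ppsat R v -> ppsat R (fun i => f (v i)).
Proof.
move=> hf n R; elim: R => {n} [n i j v|n t s v|n R IH R' IH' v|n i R IH v] /=.
- by move->.
- exact: hf.
- by case=> /IH ? /IH'.
- case=> x [xi /IH sx]; exists (f x); split; last by rewrite scons_comp in sx.
  by move: (neard_hom hf xi).
Qed.

(** * Limits of types along an ultrafilter *)

Section Limits.
Context {M : lstruct L} (lM : local_structure M).
Hypothesis near1 : forall p : type_space M, exists y, inball p 1 y.
Context {I : Type} {F : set_system I} {UF : UltraFilter F}.

Definition type_lim (p : I -> type_space M) (q : type_space M) : Prop :=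
  forall n (phi : formula L n.+1) a,
    type_of q phi a <-> F [set i | type_of (p i) phi a].

Lemma type_lim_cst q : type_lim (fun=> q) q.
Proof.
move=> n phi a; split=> [qphi|/filter_ex[]] //; exact: filterS filterT.
Qed.

(** A pattern asks, for each parameter, for a finite disjunction of memberships, and an ultrafilter
    commutes with finite disjunctions. *)
Lemma type_lim_interp (t : pattern L) (p : 'I_(pat_size t) -> I -> type_space M)
    (q : 'I_(pat_size t) -> type_space M) :
  (forall i, type_lim (p i) (q i)) ->
  F [set i | interp (t : sym (psig L)) (fun j => p j i)] ->
  interp (t : sym (psig L)) q.
Proof.
move=> pq Ft a da.
have /ultra_ex[j Fj] : F [set i | exists j, type_of (p j i) (pat_form j) a].
  by apply: filterS Ft => i; apply.
by exists j; apply/pq.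
Qed.

Lemma type_lim_unique p q r : type_lim p q -> type_lim p r -> q = r.
Proof. by move=> pq pr; apply: ltype_eq => n phi a; rewrite pq pr. Qed.

(** In the existential case the witnesses are [mu1]-close to convergent types, so they stay in a
    fixed ball and [type_limit] gives a limit witness. *)
Lemma ppsat_lim n (R : ppformula L n) (p : 'I_n -> I -> type_space M)
    (q : 'I_n -> type_space M) :
  (forall i, type_lim (p i) (q i)) ->
  F [set i | ppsat R (fun j => p j i)] -> ppsat R q.
Proof.
elim: R p q => {n} [n i j|n t s|n R IH R' IH'|n j R IH] p q pq /= FR.
- apply: type_lim_unique (pq i) _ => m phi a; rewrite pq.
  by split=> Fp; apply: filterS (filterI FR Fp) => l [/= ->].
- by apply: type_lim_interp FR => i; apply: pq.
- by split; [apply: IH pq _|apply: IH' pq _]; apply: filterS FR => i [].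
have xX i : {x : type_space M |
    (exists x, mu1 x (p j i) /\ ppsat R (scons x (fun j => p j i))) ->
    mu1 x (p j i) /\ ppsat R (scons x (fun j => p j i))}.
  apply: cid; have [[x xP]|nx] := pselect (exists x : type_space M,
    mu1 x (p j i) /\ ppsat R (scons x (fun j => p j i))); first by exists x.
  by exists (p j i).
pose x i := sval (xX i).
have Fx : F [set i | mu1 (x i) (p j i) /\ ppsat R (scons (x i) (fun j => p j i))].
  by apply: filterS FR => i; exact: (svalP (xX i)).
have [y qy] := near1 (q j).
have [z xz] : exists z, type_lim x z.
  (* The radius is 1 + 5: a point of [M] next to [x i] is within 5 of [y] by [mu1]. *)
  apply: (@type_limit _ _ lM _ F UF x 6 y).
  apply: filterS (filterI Fx ((pq j _ _ _).1 qy)) => i [/= [xp _] py].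
  have [w xw] := near1 (x i); apply: (@inball_shift _ _ _ 1 5 w) => //.
  by have /neardP := xp : neard 5 (x i) (p j i); apply.
exists z; split.
  apply: (type_lim_interp (t := mu_pattern) (p := pair2 x (p j))) => [i|].
    by case: (ord2_cases i) => ->; rewrite !(pair2l, pair2r).
  apply: filterS Fx => i [xp _].
  have e := pair2_comp (fun f : I -> type_space M => f i) x (p j).
  by apply: (eq_ind_r (interp (mu_pattern : sym (psig L))) _ e); exact: xp.
apply: (IH (scons x p)) => [i|].
  by case: (unliftP ord0 i) => [l ->|->]; rewrite ?scons0 ?sconsS.
apply: filterS Fx => i [_ /=].
by rewrite (scons_comp (fun f : I -> type_space M => f i)).
Qed.

End Limits.
End PositivePrimitive.

(** * Topology of the automorphism group and of its quotient *)

Section AutTopology.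
Context {L : language} (J : rstruct (psig L)).
Implicit Types U A : set (core_aut J).

Lemma aut_subbase_open U : core_aut_subbase U -> open U.
Proof.
move=> sU; exists [set U]; last by rewrite bigcup_set1.
move=> _ ->; exists [fset U]%fset; last by rewrite set_fset1 bigcap_set1.
by move=> W /fset1P ->; apply/mem_set.
Qed.

Lemma aut_open_preimage (X : topologicalType) (f : X -> core_aut J) A :
  (forall U, core_aut_subbase U -> open (f @^-1` U)) ->
  open A -> open (f @^-1` A).
Proof.
move=> fU [D' D'sub <-]; rewrite preimage_bigcup.
apply: bigcup_open => B /D'sub [F Fsub <-]; rewrite preimage_bigcap.
rewrite bigcap_fset big_seq; elim/big_ind: _ => [|U V|U /Fsub/set_mem];
  [exact: openT|exact: openI|exact: fU].
Qed.

Lemma aut_subbase_cvg (F : set_system (core_aut J)) (v : core_aut J) :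
  Filter F -> (forall U, core_aut_subbase U -> U v -> F U) -> F --> v.
Proof.
move=> FF FU A; rewrite /= nbhsE => -[B [[D' D'sub eB] Bv] BA].
apply: (filterS BA); move: Bv; rewrite -eB => -[C D'C Cv].
apply: filterS (bigcup_sup D'C) _.
case: (D'sub _ D'C) => E Esub eC; rewrite -eC in Cv *.
apply: filter_bigI => U EU; apply: FU; last exact: Cv.
by have /set_mem := Esub U EU.
Qed.

Local Open Scope group_scope.

(** Replacing the parameters [a] by [h a] turns a subbasic set into a subbasic set. *)
Lemma open_translate (h : core_aut J) A : open A -> open [set g | A (g * h)].
Proof.
move=> oA; rewrite -[mkset _]/((fun g : core_aut J => g * h) @^-1` A).
apply: aut_open_preimage oA => _ [n [m [R [a [b ->]]]]].
apply: aut_subbase_open; exists n, m, R, (fun i => aut_fun h (a i)), b.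
by [].
Qed.

(** The saturation of [U] is the union of its right translates by [frakg]. *)
Lemma calG_projP_open (U : set (core_aut J)) : open U -> open (@calG_proj L J @` U).
Proof.
move=> oU; suff : open (@calG_proj L J @^-1` (@calG_proj L J @` U)) by [].
have -> : @calG_proj L J @^-1` (@calG_proj L J @` U) =
    \bigcup_(h in @frakg L J) [set g | U (g * h)].
  rewrite eqEsubset; split=> [g [u Uu /esym/calG_projP gu]|g [h fh Ugh]].
    by exists (g^-1 * u) => //=; rewrite mulgA mulgV mul1g.
  by exists (g * h) => //; apply/esym/calG_projP; rewrite mulgA mulVg mul1g.
by apply: bigcup_open => h _; apply: open_translate.
Qed.

Lemma calG_proj_compact A : compact A -> compact (@calG_proj L J @` A).
Proof.
move=> cA; apply: continuous_compact cA; apply: continuous_subspaceT.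
exact: pi_continuous.
Qed.

End AutTopology.

(** * Lifting automorphisms of the model to the core *)

Section Core.
Context (L : language) (T : theory L) (T_DP : doubling T).
Context (M : lstruct L) (M_model : model T M) (k : nat) (M_bounded : orbit_bounded k M).
Context (J : rstruct (psig L)) (J_core : is_core T J).
Context (iota : J -> type_space M) (iota_emb : embedding iota).
Context (rho : type_space M -> J) (rho_hom : homomorphism rho).
Context (rho_iota : forall p : J, rho (iota p) = p).

Local Open Scope group_scope.

Let near1 (p : type_space M) : exists y, inball p 1 y := inball1 T_DP M_model p.

Let lM : local_structure M := M_model.1.

Definition retr (p : type_space M) : type_space M := iota (rho p).

Lemma comp_hom (A B C : rstruct (psig L)) (g : B -> C) (f : A -> B) :
  homomorphism g -> homomorphism f -> homomorphism (fun x => g (f x)).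
Proof. by move=> hg hf R v Rv; apply: (hg R (fun i => f (v i))); apply: hf. Qed.

Lemma retr_hom : homomorphism retr.
Proof. exact: comp_hom (emb_hom iota_emb) rho_hom. Qed.

Lemma retr_idem p : retr (retr p) = retr p.
Proof. by rewrite /retr rho_iota. Qed.

Lemma type_act1 (p : type_space M) : type_act 1 p = p.
Proof. by apply: ltype_eq => n phi a. Qed.

Lemma type_actM (g h : aut M) (p : type_space M) :
  type_act (g * h) p = type_act g (type_act h p).
Proof. by apply: ltype_eq => n phi a. Qed.

Definition core_lift_spec (u : aut M -> aut J) : Prop :=
  forall g p, u g p = rho (type_act g (iota p)).

Lemma core_lift_ex : exists u, core_lift_spec u.
Proof.
have /choice[u uP] : forall g : aut M, exists v : aut J,
    forall p, v p = rho (type_act g (iota p)).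
  move=> g; have [|v vP] := core_endo J_core (f := fun p => rho (type_act g (iota p))).
    apply: (comp_hom rho_hom (f := fun p => type_act g (iota p))).
    exact: comp_hom (type_act_hom g) (emb_hom iota_emb).
  by exists v => p; rewrite vP.
by exists u.
Qed.

Section Lift.
Context (u : aut M -> aut J) (uP : core_lift_spec u).

Lemma core_lift1 : u 1 = 1.
Proof. by apply: aut_ext => p; rewrite uP type_act1 rho_iota. Qed.

Lemma core_liftM_sh g h (a : J) : sh_core T k (((u g * u h)^-1 * u (g * h)) a) a.
Proof.
exists M; split=> //; first by exists k.
(* Neighbours in [J] may be tested through any embedding; composing [iota] with [u g * u h] cancels
   the inverse. *)
exists (fun p => iota ((u g * u h) p)); split.
  have [iota_inj iota_int] := iota_emb.
  split=> [p q /iota_inj|R v]; first exact: (can_inj (aut_funK _)).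
  by rewrite (aut_interp (u g * u h)) iota_int.
apply: sh_fin_type => //.
have -> : (u g * u h) (((u g * u h)^-1 * u (g * h)) a) = u (g * h) a.
  exact: (aut_invK (u g * u h)).
rewrite /= !uP type_actM.
(* With [p := type_act h (iota a)], the two types are the images of [p] and [retr p] under [retr]
   after the action of [g]. *)
apply: (sh_fin_hom retr_hom); apply: (sh_fin_hom (type_act_hom g)).
apply: (retract_sh_fin near1 M_bounded retr_hom retr_idem).
Qed.

End Lift.

(** * Bounded sets of automorphisms of the core *)

Lemma neard_iota l (x y : J) : neard l x y <-> neard l (iota x) (iota y).
Proof. exact: neard_emb. Qed.

Lemma core_neard_trans l m (x y z : J) : neard l x y -> neard m y z -> neard (l + m) x z.
Proof. rewrite !neard_iota; exact: neard_trans. Qed.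

Lemma core_neard_sym l (x y : J) : neard l x y -> neard l y x.
Proof. rewrite !neard_iota; exact: neard_sym. Qed.

Lemma core_neard_aut (g : aut J) l (x y : J) : neard l x y -> neard l (g x) (g y).
Proof. exact: neard_hom (emb_hom (aut_emb g)) _ _ _. Qed.

Lemma core_nfard l (x y : J) : ~ fard l x y -> neard (l + l).+2 x y.
Proof. rewrite (fard_emb iota_emb) neard_iota; exact: nfard_neard. Qed.

Variable a0 : J.

Definition bounded_auts l : set (core_aut J) := [set g | neard l (aut_fun g a0) a0].

Definition nonfar_auts l : set (core_aut J) := [set g | ~ fard l (aut_fun g a0) a0].

Lemma aut_pair_subbase (R : ppformula L 2) :
  core_aut_subbase [set g : core_aut J | ~ ppsat R (pair2 (aut_fun g a0) a0)].
Proof.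
exists 1%N, 1%N, R, (fun=> a0), (fun=> a0); congr mkset; apply/funext => g.
congr (~ ppsat R _); apply/funext => i.
rewrite -[RHS]/(vcat (fun _ : 'I_1 => aut_fun g a0) (fun _ : 'I_1 => a0) i).
case: (ord2_cases i) => ->.
  have -> : ord0 = lshift 1 (@ord0 0) by apply: val_inj.
  by rewrite vcatl.
have -> : lift ord0 ord0 = rshift 1 (@ord0 0) by apply: val_inj.
by rewrite vcatr.
Qed.

Lemma closed_bounded_auts l : closed (bounded_auts l).
Proof.
rewrite -[bounded_auts l]setCK; apply: open_closedC; apply: aut_subbase_open.
exact: (aut_pair_subbase (PPDef (t := near_pattern l) id)).
Qed.

Lemma open_nonfar_auts l : open (nonfar_auts l).
Proof.
apply: aut_subbase_open.
exact: (aut_pair_subbase (PPDef (t := far_pattern l) id)).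
Qed.

Lemma bounded_auts_compact l : compact (bounded_auts l).
Proof.
rewrite compact_ultra => F UF FB.
have [y0 ay0] := near1 (iota a0).
have /choice[f fP] : forall x : J, exists q : type_space M,
    type_lim (F := F) (fun g : core_aut J => iota (aut_fun g x)) q.
  move=> x; have [m xm] := neard_ex near1 (iota x) (iota a0) lM.
  (* The values at [x] stay in one ball: [g x] is within [m] of [g a0], which is within [l] of
     [a0]. *)
  apply: (@type_limit _ _ lM _ F UF _ (1 + (m + l))%N y0).
  apply: filterS FB => g ga0; have [y xy] := near1 (iota (aut_fun g x)).
  have /neard_iota/neardP xa : neard (m + l) (aut_fun g x) a0.
    apply: core_neard_trans ga0; apply: (@core_neard_aut g).
    exact/neard_iota.
  exact: inball_shift (xa _ _ xy ay0) xy.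
pose fJ x := rho (f x).
have [|v vP] := core_endo J_core (f := fJ).
  apply: (comp_hom rho_hom) => t w tw.
  apply: (type_lim_interp (F := F)) => [i|]; first exact: fP.
  apply: filterS filterT => g _.
  by move/(aut_interp g)/(emb_hom iota_emb): tw.
exists v; split.
  rewrite /bounded_auts /= -vP /fJ -{2}(rho_iota a0); apply: (neard_hom rho_hom).
  apply: (type_lim_interp (F := F) (t := near_pattern l)
    (p := pair2 (fun g : core_aut J => iota (aut_fun g a0)) (fun=> iota a0))) => [i|].
    by case: (ord2_cases i) => ->; [exact: fP | exact: type_lim_cst].
  apply: filterS FB => g /neard_iota.
  have e := pair2_comp (fun p : core_aut J -> type_space M => p g)
    (fun g : core_aut J => iota (aut_fun g a0)) (fun=> iota a0).
  by move=> H; apply: (eq_ind_r (interp (near_pattern l : sym (psig L))) _ e); exact: H.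
(* A pp relation holding almost everywhere along [F] would pass to the limit types by [ppsat_lim],
   and through [rho] to [v]. *)
apply: aut_subbase_cvg => _ [n [m [R [a [b ->]]]]] nR.
have [//|FR] := in_ultra_setVsetC [set g : core_aut J | ~ ppsat R
  (vcat (fun i => aut_fun g (a i)) b)] UF.
case: nR; rewrite -[X in ppsat R X]/(vcat (fun i => v (a i)) b).
have -> : vcat (fun i => v (a i)) b =
    fun i => rho (vcat (fun i => f (a i)) (fun i => iota (b i)) i).
  rewrite vcat_comp; congr vcat; apply/funext => i; first by rewrite -vP.
  by rewrite rho_iota.
apply: (ppsat_hom rho_hom); apply: (ppsat_lim lM near1 (F := F)
  (p := vcat (fun i g => iota (aut_fun g (a i))) (fun i _ => iota (b i)))) => [i|].
  rewrite -(splitK i); case: (fintype.split i) => j; rewrite ?vcatl ?vcatr.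
    exact: fP.
  exact: type_lim_cst.
apply: filterS FR => g /contrapT /(ppsat_hom (emb_hom iota_emb)).
rewrite vcat_comp => H.
have e := vcat_comp (fun p : core_aut J -> type_space M => p g)
  (fun i (g : core_aut J) => iota (aut_fun g (a i))) (fun i _ => iota (b i)).
by apply: (eq_ind_r (ppsat R) _ e); exact: H.
Qed.

(** Tested on the open neighbourhood [U] of [a0], an element [h] of [frakg] sends some [x] near [a0]
    to a point near [a0]. Each closeness costs 4 by [core_nfard], whence 8. *)
Lemma frakg_bounded : @frakg L J `<=` bounded_auts 8.
Proof.
move=> h fh; pose U : set (core_space J) := [set x | ~ fard 1 x a0].
have oU : open U.
  exists [set U]; last by rewrite bigcup_set1.
  move=> _ ->; exists [fset U]%fset; last by rewrite set_fset1 bigcap_set1.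
  move=> W /fset1P ->; apply/mem_set.
  exists 1%N, (PPDef (t := far_pattern 1) id), (fun=> a0); congr mkset.
  apply/funext => x; congr (~ _); rewrite /fard /=; congr (interp _ _).
  apply/funext => i; case: (ord2_cases i) => ->.
    by rewrite scons0.
  by rewrite sconsS.
have Ua0 : U a0 by rewrite /U /= (fard_emb iota_emb); apply: fard_refl.
have [_ [[x Ux <-] Uhx]] := fh U oU (ex_intro _ a0 Ua0).
move/core_nfard: Ux => xa; move/core_nfard: Uhx => hxa.
apply: (core_neard_trans (l := 4) (m := 4)) hxa.
by apply: core_neard_sym; apply: (@core_neard_aut h).
Qed.

Lemma bounded_autsM l m g h :
  bounded_auts l g -> bounded_auts m h -> bounded_auts (m + l) (g * h).
Proof. by move=> gl hm; apply: core_neard_trans gl; apply: (@core_neard_aut g). Qed.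

Lemma nonfar_bounded l : nonfar_auts l `<=` bounded_auts (l + l).+2.
Proof. by move=> g /core_nfard. Qed.

(** The images of the [nonfar_auts n] are open, increase with [n] and cover the quotient. *)
Lemma compact_calG_nonfar (K : set (calG J)) :
  compact K -> exists n, K `<=` @calG_proj L J @` nonfar_auts n.
Proof.
move=> /compact_near_coveringP cK.
have [|n _ nP] := cK nat \oo (fun n x => (@calG_proj L J @` nonfar_auts n) x) _.
  elim/calG_ind => g _.
  have [n gn] := neard_ex near1 (iota (aut_fun g a0)) (iota a0) lM.
  exists (@calG_proj L J @` nonfar_auts n.+1, [set m | (n.+1 <= m)%N]).
    split=> /=; last by exists n.+1.
    apply: open_nbhs_nbhs; split; first exact/calG_projP_open/open_nonfar_auts.
    exists g => //; rewrite /nonfar_auts /= (fard_emb iota_emb).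
    exact: neard_nfard gn.
  move=> [_ m] /= [[h hn <-] nm]; exists h => //.
  move: hn; rewrite /nonfar_auts /= !(fard_emb iota_emb) => hn hm.
  by apply: hn; apply: fard_le hm.
by exists n; apply: nP => /=.
Qed.

(** * Boundedness and precompactness in the quotient *)

Section LiftBounded.
Context (u : aut M -> aut J) (uP : core_lift_spec u).

Lemma precompact_preimage_bounded (C : set (calG J)) :
  precompact C -> bounded ((fun g => calG_proj (u g)) @^-1` C).
Proof.
move=> [K CK [cK _]]; have [n Kn] := compact_calG_nonfar cK.
have [b ab] := near1 (iota a0).
(* The terms bound, in order, the distance from [q] to [retr q], the displacement by an element of
   [frakg], and that by an element of [nonfar_auts n]. *)
pose r := (4 + (8 + (n + n).+2))%N; exists b, b, r => w /CK/Kn[g gn /calG_projP fs].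
have us : bounded_auts (8 + (n + n).+2) (u w).
  have -> : u w = g * (g^-1 * u w) :> core_aut J by rewrite mulgA mulgV mul1g.
  apply: bounded_autsM (frakg_bounded fs); exact: nonfar_bounded.
pose q := type_act w (iota a0).
have qw : inball q 1 (w b) by apply/inball_act.
have qr := nfard_neard (retract_nfard near1 retr_hom (retr_idem q)).
move: us; rewrite /bounded_auts /= neard_iota uP -/(retr _) -/q => ra.
by have /neardP/(_ _ _ qw ab)/ball_sym := neard_trans near1 qr ra.
Qed.

Lemma bounded_image_precompact (W : set (aut M)) :
  bounded W -> precompact ((fun g => calG_proj (u g)) @` W).
Proof.
move=> [a [c [n cW]]].
have [b ab] := near1 (iota a0).
have [e ba] := lM b a; have [e' cb] := lM c b.
(* The path runs from [w b] to [w a], then [c], then [b]; the 4 comes from [neard_ball]. *)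
pose l := (e + (n + e') + 4)%N.
have ul w : W w -> bounded_auts l (u w).
  move=> Ww; rewrite /bounded_auts /= uP -{2}(rho_iota a0); apply: (neard_hom rho_hom).
  apply: (@neard_ball _ _ _ _ _ (w b) b) => //; first by apply/inball_act.
  apply: ball_trans (ball_trans (ball_sym (cW w Ww)) cb).
  by have := (ball_aut w e b a).1 ba.
(* The frakg-saturation E of the bounded set is bounded, hence so is its closure
   Z, which is still saturated: its image is closed although no separation
   property of G(T) is available. *)
pose E := \bigcup_(s in @frakg L J) [set g * s | g in bounded_auts l].
have E_sat g s : frakg s -> E g -> E (g * s).
  move=> fs [t ft [h hl <-]]; exists (t * s); first exact: frakgM.
  by exists h => //; rewrite mulgA.
pose Z := closure E.
have Z_sat g s : frakg s -> Z g -> Z (g * s).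
  move=> fs Zg B; rewrite nbhsE => -[B' [oB' B'gs] B'B].
  have [x [Ex B'xs]] : E `&` [set x | B' (x * s)] !=set0.
    by apply: Zg; apply: open_nbhs_nbhs; split=> //; apply: open_translate.
  by exists (x * s); split; [apply: E_sat | apply: B'B].
have ZB : Z `<=` bounded_auts (8 + l).
  rewrite ((closure_id _).1 (@closed_bounded_auts (8 + l))).
  apply: closureS => _ [s fs [g gl <-]].
  by apply: bounded_autsM => //; apply: frakg_bounded.
have cZ : compact Z.
  by apply: subclosed_compact ZB; [exact: closed_closure | exact: bounded_auts_compact].
exists (@calG_proj L J @` Z).
  move=> _ [w Ww <-]; exists (u w) => //; apply: subset_closure.
  by exists 1; [exact: frakg1|exists (u w); [exact: ul|rewrite mulg1]].
split; first exact: calG_proj_compact.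
rewrite -[_ @` _]setCK; apply: open_closedC.
(* Since [Z] is saturated, the complement of its image is the image of its complement, open because
   the projection is open. *)
have -> : ~` (@calG_proj L J @` Z) = @calG_proj L J @` ~` Z.
  rewrite eqEsubset; split; elim/calG_ind => g.
    by move=> nZ; exists g => // Zg; apply: nZ; exists g.
  move=> [h nZh hg] [h' Zh' h'g]; apply: nZh.
  have /calG_projP fh : calG_proj h' = calG_proj h by rewrite hg.
  have -> : h = h' * (h'^-1 * h) by rewrite mulgA mulgV mul1g.
  exact: Z_sat.
by apply: calG_projP_open; apply: closed_openC; apply: closed_closure.
Qed.

End LiftBounded.

End Core.

Theorem theorem3p16 (L : language) (T : theory L)
    (T_complete : complete_theory T) (T_DP : doubling T)
    (M : lstruct L) (M_model : model T M)
    (k : nat) (M_bounded : orbit_bounded k M)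
    (J : rstruct (psig L)) (J_core : is_core T J)
    (iota : J -> type_space M) (iota_emb : embedding iota)
    (rho : type_space M -> J) (rho_hom : homomorphism rho)
    (rho_iota : forall p : J, rho (iota p) = p) :
  exists phi : aut M -> calG J,
    [/\ canonical_map iota rho phi,
        quasi_hom (sh_set (J := J) T k) phi,
        (forall C : set (calG J), precompact C -> bounded (phi @^-1` C)) &
        (forall W : set (aut M), bounded W -> precompact (phi @` W))].
Proof.
have [u uP] := core_lift_ex J_core iota_emb rho_hom.
(* Displacement in [J] is measured at the retract of a type realized in [M]. *)
have [o] := lstruct_inhabited M; pose a0 := rho (tp M_model.1 o).
exists (fun g => calG_proj (u g)); split.
- by move=> g; exists (u g); split=> // p; rewrite uP.
- split=> [|x y]; first by rewrite (core_lift1 rho_iota uP).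
  exists (calG_proj ((u x * u y^-1)^-1 * u (x * y^-1))%g).
    exists ((u x * u y^-1)^-1 * u (x * y^-1))%g => // a.
    exact: (core_liftM_sh T_DP M_model M_bounded iota_emb rho_hom rho_iota uP).
  by rewrite -[RHS]/(calG_mul (calG_mul _ _) _) !calG_mulE mulVKg.
- exact: (precompact_preimage_bounded T_DP M_model iota_emb rho_hom rho_iota a0 uP).
- exact: (bounded_image_precompact T_DP M_model J_core iota_emb rho_hom rho_iota a0 uP).
Qed.
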